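(* Let $A$ be an oriented Lie algebroid over $M$ of rank $m\ge 3$ and let $\Pi\in\Gamma(\wedge^mA)$ be a non-vanishing (i.e. not identically zero) $m$-multisection of $A$. Then the Leibniz algebroid structure on $\wedge^{m-1}A^*$ associated with $\Pi$ is a Lie algebroid.
   Context: A Lie algebroid is oriented if it is oriented as a vector bundle. $\rho$ is the anchor of $A$, $d_A$ the Lie algebroid differential on $\Gamma(\wedge^\bullet A^* )$; $\mathcal L_X=\iota_Xd_A+d_A\iota_X$ on forms. Contractions: multisections are evaluated by $P(\alpha_1\wedge\cdots\wedge\alpha_k)=P(\alpha_1,\dots,\alpha_k)$, with $(X_1\wedge\cdots\wedge X_k)(\alpha_1,\dots,\alpha_k)=\det(\alpha_i(X_j))$; for $\alpha\in\Gamma A^*$, $(\iota_\alpha P)(\beta)=P(\alpha\wedge\beta)$ and $\iota_{\alpha_1\wedge\cdots\wedge\alpha_k}=\iota_{\alpha_k}\circ\cdots\circ\iota_{\alpha_1}$, extended linearly. $\Pi^\sharp\alpha=\iota_\alpha\Pi$. When $m=\operatorname{rank}A\ge3$ and $A$ is oriented, every $\Pi\in\Gamma(\wedge^mA)$ is a Nambu structure of order $m$ on $A$, i.e. $\mathcal L_{\Pi^\sharp\alpha}\Pi=(-1)^m(\iota_{d_A\alpha}\Pi)\Pi$ for all $\alpha\in\Gamma(\wedge^{m-1}A^* )$ (where $\mathcal L_XP=[X,P]$ is the Schouten bracket). The associated Leibniz algebroid structure on $\wedge^{m-1}A^*$ has anchor $\rho\circ\Pi^\sharp$ and bracket $[\alpha,\beta]=\mathcal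 L_{\Pi^\sharp\alpha}\beta+(-1)^m(\iota_{d_A\alpha}\Pi)\beta$ on sections. (A Leibniz algebroid is defined like a Lie algebroid but with a bracket satisfying the left Leibniz identity $[X,[Y,Z]]=[[X,Y],Z]+[Y,[X,Z]]$ and not required to be skew-symmetric.) *)

(* Defs.v *)
From HB Require Import structures.
From mathcomp Require Import all_boot all_order all_algebra all_fingroup.
From mathcomp Require Import all_classical all_reals all_analysis.

Set Implicit Arguments.
Unset Strict Implicit.
Unset Printing Implicit Defensive.

Import Order.TTheory GRing.Theory Num.Theory.
Import numFieldNormedType.Exports.

Local Open Scope classical_set_scope.
Local Open Scope ring_scope.

Section AlternatingForms.
Variables (R : realType) (V : lmodType R).

Definition multilinear k (w : ('I_k -> V) -> R) : Prop :=
  forall (v : 'I_k -> V) i a (x y : V),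
    w [eta v with i |-> a *: x + y] =
    a * w [eta v with i |-> x] + w [eta v with i |-> y].

Definition alternating k (w : ('I_k -> V) -> R) : Prop :=
  forall (v : 'I_k -> V) i j, i != j -> v i = v j -> w v = 0.

Definition is_altform k : {pred ('I_k -> V) -> R} :=
  fun w => `[< multilinear w /\ alternating w >].

Record altform k := AltForm {
  altform_fun :> ('I_k -> V) -> R;
  altform_prop : altform_fun \in @is_altform k }.

HB.instance Definition _ k := [isSub for @altform_fun k].
HB.instance Definition _ k := [Choice of altform k by <:].

Lemma altformP k (w : altform k) : multilinear w /\ alternating w.
Proof. by case: w => w /= /asboolP. Qed.

Lemma altform_submod_closed k : submod_closed (@is_altform k).
Proof.
split=> [|a u w /asboolP[uM uA] /asboolP[wM wA]]; apply/asboolP; split.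
- by move=> v i a x y; rewrite mulr0 addr0.
- by [].
- move=> v i b x y.
  have E z : (a *: u + w) z = a * u z + w z by [].
  rewrite !E uM wM mulrDr [b * (_ + _)]mulrDr !mulrA [b * a]mulrC -!addrA.
  by congr (_ + _); rewrite addrCA.
- move=> v i j ij vij.
  by have -> : (a *: u + w) v = a * u v + w v by []; rewrite (uA _ _ _ ij) // (wA _ _ _ ij) // mulr0 addr0.
Qed.

HB.instance Definition _ k :=
  GRing.isSubmodClosed.Build R _ (@is_altform k) (@altform_submod_closed k).
HB.instance Definition _ k := [SubChoice_isSubLmodule of altform k by <:].

(* (a_1 /\ ... /\ a_k)(v_1, ..., v_k) = det (a_p (v_q)), where a_p is the I_p-th
   component of the linear map c. *)
Section BasisForm.
Variables (r k : nat) (c : {linear V -> 'rV[R]_r}) (I : 'I_k -> 'I_r).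

Definition basis_form_fun (v : 'I_k -> V) : R :=
  \det (\matrix_(p, q) c (v q) 0 (I p)).

Lemma basis_form_subproof : basis_form_fun \in @is_altform k.
Proof.
apply/asboolP; split => [v i a x y|v i j ij vij]; rewrite /basis_form_fun.
- set B := \matrix_(p, q) c ([eta v with i |-> x] q) 0 (I p).
  set C := \matrix_(p, q) c ([eta v with i |-> y] q) 0 (I p).
  rewrite -det_tr -(det_tr B) -(det_tr C) -[\det C^T]mul1r.
  apply: (@determinant_multilinear _ _ _ _ _ i).
  + by apply/rowP => p; rewrite !mxE /= eqxx linearP !mxE mul1r.
  + by apply/matrixP => p q; rewrite !mxE /= eq_sym (negbTE (neq_lift _ _)).
  + by apply/matrixP => p q; rewrite !mxE /= eq_sym (negbTE (neq_lift _ _)).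
- rewrite -det_tr; apply: (determinant_alternate ij) => p.
  by rewrite !mxE vij.
Qed.

Definition basis_form : altform k := AltForm basis_form_subproof.
End BasisForm.

(* (i_v w)(u_1, ..., u_k) = w (v, u_1, ..., u_k). *)
Section Contraction.
Variables (k : nat) (v : V) (w : altform k.+1).

Definition cons_arg (u : 'I_k -> V) (i : 'I_k.+1) : V :=
  if unlift ord0 i is Some j then u j else v.

Definition contract_fun (u : 'I_k -> V) : R := w (cons_arg u).

Lemma contract_subproof : contract_fun \in @is_altform k.
Proof.
have [wM wA] := altformP w.
apply/asboolP; split => [u i a x y|u i j ij uij]; rewrite /contract_fun.
- have E z : cons_arg [eta u with i |-> z] =
             [eta cons_arg u with lift ord0 i |-> z].
    apply/funext => p; rewrite /cons_arg /=.
    case: (unliftP ord0 p) => [q ->|->].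
      by rewrite (inj_eq (@lift_inj _ ord0)).
    by rewrite (negbTE (neq_lift _ _)).
  by rewrite !E wM.
- apply: (wA _ (lift ord0 i) (lift ord0 j)).
    by rewrite (inj_eq (@lift_inj _ ord0)).
  by rewrite /cons_arg !liftK.
Qed.

Definition contract : altform k := AltForm contract_subproof.
End Contraction.

(* The normalization is the one for which
   (a_1 /\ ... /\ a_k)(v_1, ..., v_k) = det (a_i (v_j)) for 1-forms a_i.
   The degree n of the product is only required to be provably k + l. *)
Section Wedge.
Variables (k l n : nat) (e : (k + l)%N = n) (w : altform k) (z : altform l).

Definition wedge_fun (v : 'I_n -> V) : R :=
  (k`! * l`!)%:R^-1 *
  \sum_(s : 'S_(k + l)) (-1) ^+ s *
    (w (fun i => v (cast_ord e (s (lshift l i)))) *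
     z (fun j => v (cast_ord e (s (rshift k j))))).

Lemma wedge_subproof : wedge_fun \in @is_altform n.
Proof.
have [wM wA] := altformP w; have [zM zA] := altformP z.
rewrite /wedge_fun; case: n / e => /=.
have cE i : cast_ord (erefl (k + l)%N) i = i by apply: val_inj.
apply/asboolP; split => [v i a x y|v i j ij vij].
- rewrite [a * _]mulrCA -mulrDr; congr (_ * _).
  rewrite mulr_sumr -big_split /=; apply: eq_bigr => s _.
  rewrite [a * _]mulrCA -mulrDr; congr (_ * _).
  have [p ->] : exists p, i = s p by exists (s^-1 i)%g; rewrite permKV.
  case: (split_ordP p) => q ->.
  + have E t : (fun i0 : 'I_k => [eta v with s (lshift l q) |-> t]
        (cast_ord (erefl (k + l)%N) (s (lshift l i0)))) =
        [eta (fun i0 => v (s (lshift l i0))) with q |-> t].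
      apply/funext => b /=; rewrite cE (inj_eq perm_inj).
      by rewrite (inj_eq (@lshift_inj _ _)).
    have F t : (fun i0 : 'I_l => [eta v with s (lshift l q) |-> t]
        (cast_ord (erefl (k + l)%N) (s (rshift k i0)))) =
        (fun i0 => v (s (rshift k i0))).
      by apply/funext => b /=; rewrite cE (inj_eq perm_inj) eq_rlshift.
    by rewrite !E !F wM mulrDl mulrA.
  + have E t : (fun i0 : 'I_l => [eta v with s (rshift k q) |-> t]
        (cast_ord (erefl (k + l)%N) (s (rshift k i0)))) =
        [eta (fun i0 => v (s (rshift k i0))) with q |-> t].
      apply/funext => b /=; rewrite cE (inj_eq perm_inj).
      by rewrite (inj_eq (@rshift_inj _ _)).
    have F t : (fun i0 : 'I_k => [eta v with s (rshift k q) |-> t]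
        (cast_ord (erefl (k + l)%N) (s (lshift l i0)))) =
        (fun i0 => v (s (lshift l i0))).
      by apply/funext => b /=; rewrite cE (inj_eq perm_inj) eq_lrshift.
    by rewrite !E !F zM mulrDr mulrCA.
- apply/eqP; rewrite mulf_eq0; apply/orP; right; apply/eqP.
  pose F (s : 'S_(k + l)) : R := (-1) ^+ s *
    (w (fun i => v (cast_ord (erefl (k + l)%N) (s (lshift l i)))) *
     z (fun j => v (cast_ord (erefl (k + l)%N) (s (rshift k j))))).
  have FJ s : F (s * tperm i j)%g = - F s.
    rewrite /F odd_permM odd_tperm ij signr_addb /= expr1 mulrN1 mulNr.
    have E t : v (tperm i j t) = v t.
      by case: tpermP => // ->; rewrite vij.
    congr (- (_ * (w _ * z _))); apply/funext => b; by rewrite !cE permM E.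
  change (\sum_s F s = 0).
  have S : \sum_s F s = - \sum_s F s.
    rewrite -sumrN [LHS](reindex_inj (mulIg (tperm i j))) /=.
    by apply: eq_bigr => s _; rewrite FJ.
  apply/eqP; rewrite -[_ == 0](mulrn_eq0 _ 2) mulr2n.
  by rewrite {1}S addNr.
Qed.

Definition wedge : altform n := AltForm wedge_subproof.
End Wedge.

End AlternatingForms.

Arguments wedge {R V k l n} e w z.
Arguments contract {R V k} v w.

(* The multivectors of degree k are the linear functionals on the alternating
   k-forms: X_1 /\ ... /\ X_k is the functional w |-> w (X_1, ..., X_k), whose
   value on a_1 /\ ... /\ a_k is det (a_i (X_j)).  The dual of a vector space U
   is represented by [altform U 1]. *)

Section Multivectors.
Variables (R : realType) (V : lmodType R).

Definition pairing k (P : altform (altform V k) 1) (w : altform V k) : R :=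
  P (fun=> w).

(* (i_a P)(b) = P (a /\ b); this agrees with
   i_(a_1 /\ ... /\ a_k) = i_(a_k) o ... o i_(a_1). When b has degree 0 it says
   that i_a P is the number [pairing P a]. *)
Section Interior.
Variables (k l n : nat) (e : (k + l)%N = n).
Variables (a : altform V k) (P : altform (altform V n) 1).

Definition interior_fun (b : 'I_1 -> altform V l) : R :=
  pairing P (wedge e a (b ord0)).

Lemma interior_subproof : interior_fun \in @is_altform R (altform V l) 1.
Proof.
have [PM _] := altformP P.
apply/asboolP; split => [v i c x y|v i j]; last by rewrite !ord1 eqxx.
rewrite /interior_fun /= !(ord1 i) eqxx /pairing.
have -> : wedge e a (c *: x + y) = c *: wedge e a x + wedge e a y.
  apply: val_inj; apply/funext => u /=.
  have -> : (c *: wedge_fun e a x + wedge_fun e a y) u =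
            c * wedge_fun e a x u + wedge_fun e a y u by [].
  rewrite /wedge_fun [c * _]mulrCA -mulrDr; congr (_ * _).
  rewrite mulr_sumr -big_split /=; apply: eq_bigr => s _; rewrite [c * _]mulrCA -mulrDr; congr (_ * _).
  set f : 'I_l -> V := fun j => u (cast_ord e (s (rshift k j))).
  transitivity (a (fun i => u (cast_ord e (s (lshift l i)))) * (c * x f + y f)).
    by [].
  by rewrite mulrDr mulrCA.
have E t : (fun=> t) = [eta (fun=> 0) with ord0 |-> t] :> ('I_1 -> altform V n).
  by apply/funext => b; rewrite /= !ord1.
by rewrite E PM -!E.
Qed.

Definition interior : altform (altform V l) 1 := AltForm interior_subproof.
End Interior.

(* The inverse of the canonical isomorphism from V to the dual of its space of
   1-forms, for V of finite dimension. *)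
Definition vector_of (F : altform (altform V 1) 1) : V :=
  xget 0 [set v | forall b : altform V 1, b (fun=> v) = pairing F b].

Definition sharp m (P : altform (altform V m.+1) 1) (a : altform V m) : V :=
  vector_of (interior (addn1 m) a P).

End Multivectors.

Fixpoint Ck (R : realType) n k (U : set 'rV[R]_n) (f : 'rV[R]_n -> R) : Prop :=
  match k with
  | 0 => forall y, U y -> {for y, continuous f}
  | k'.+1 => (forall y, U y -> differentiable f y) /\
             (forall i, Ck k' U (fun y => 'D_(delta_mx 0 i) f y))
  end.

Definition Cinfty (R : realType) n (U : set 'rV[R]_n) (f : 'rV[R]_n -> R) :=
  forall k, Ck k U f.

Record chart (R : realType) n (M : topologicalType) := Chart {
  chart_dom : set M;
  chart_map : M -> 'rV[R]_n;
  chart_inv : 'rV[R]_n -> M;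
  chart_open : open chart_dom;
  chart_im_open : open (chart_map @` chart_dom);
  chart_mapK : forall x, chart_dom x -> chart_inv (chart_map x) = x;
  chart_map_cont : forall x, chart_dom x -> {for x, continuous chart_map};
  chart_inv_cont : forall y, (chart_map @` chart_dom) y ->
    {for y, continuous chart_inv} }.

Record manifold (R : realType) n := Manifold {
  manifold_space :> topologicalType;
  atlas : set (chart R n manifold_space);
  manifold_hausdorff : hausdorff_space manifold_space;
  manifold_second_countable : @second_countable manifold_space;
  atlas_cover : forall x, exists2 c, atlas c & chart_dom c x;
  atlas_compatible : forall c c', atlas c -> atlas c' -> forall i,
    Cinfty (chart_map c @` (chart_dom c `&` chart_dom c'))
           (fun y => chart_map c' (chart_inv c y) 0 i) }.

Arguments atlas {R n} M : rename.

Section Manifold.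
Variables (R : realType) (n : nat) (M : manifold R n).

Definition smooth_on (W : set M) (f : M -> R) : Prop :=
  forall c, atlas M c ->
    Cinfty (chart_map c @` (chart_dom c `&` W)) (f \o chart_inv c).

Definition smooth (f : M -> R) : Prop := smooth_on setT f.

(* Derivations at x of the algebra of smooth functions; the value of v on a
   function which is not smooth is irrelevant. *)
Definition is_tangent_vector (x : M) (v : (M -> R) -> R) : Prop :=
  (forall a f g, smooth f -> smooth g ->
     v (fun y => a * f y + g y) = a * v f + v g) /\
  (forall f g, smooth f -> smooth g ->
     v (fun y => f y * g y) = f x * v g + v f * g x).

(* Only the values of the maps at the points of [triv_dom] matter. *)
Record trivialization r (E : M -> lmodType R) := Trivialization {
  triv_dom : set M;
  triv_map : forall x, {linear E x -> 'rV[R]_r};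
  triv_inv : forall x, 'rV[R]_r -> E x }.

Definition frame r (E : M -> lmodType R) (t : trivialization r E) x (i : 'I_r) :
  E x := triv_inv t x (delta_mx 0 i).

Record bundle r := Bundle {
  fiber :> M -> lmodType R;
  trivs : set (trivialization r fiber) }.

Arguments trivs {r} E : rename.

Definition is_vector_bundle r (E : bundle r) : Prop :=
  [/\ forall t, trivs E t ->
        [/\ open (triv_dom t),
            forall x, triv_dom t x -> cancel (triv_map t x) (triv_inv t x)
          & forall x, triv_dom t x -> cancel (triv_inv t x) (triv_map t x)],
      forall x, exists2 t, trivs E t & triv_dom t x
    & forall t t', trivs E t -> trivs E t' -> forall i j,
        smooth_on (triv_dom t `&` triv_dom t')
                  (fun x => triv_map t' x (frame t x i) 0 j)].

Definition section r (E : bundle r) := forall x, E x.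

Definition smooth_section r (E : bundle r) (s : section E) : Prop :=
  forall t, trivs E t -> forall i,
    smooth_on (triv_dom t) (fun x => triv_map t x (s x) 0 i).

(* An orientation is given by the set of the positively oriented bases of each
   fiber; near each point of a trivialization it must be one of the two
   orientations induced from R^r. *)
Definition is_orientation r (E : bundle r)
    (pos : forall x, ('I_r -> E x) -> Prop) : Prop :=
  forall t, trivs E t -> forall x0, triv_dom t x0 ->
    exists sg : bool, \forall x \near x0, forall b : 'I_r -> E x,
      pos x b <-> 0 < (-1) ^+ sg * \det (\matrix_i triv_map t x (b i)).

(* The bundle of k-forms is trivialized by the forms e^(I_1) /\ ... /\ e^(I_k)
   with I increasing. *)

Definition increasing k r : {set {ffun 'I_k -> 'I_r}} :=
  [set I : {ffun 'I_k -> 'I_r} |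
    [forall p : 'I_k, forall q : 'I_k, (p < q)%N ==> (I p < I q)%N]]%SET.

Definition multi_index k r (a : 'I_#|increasing k r|) : {ffun 'I_k -> 'I_r} :=
  enum_val a.

Section Forms.
Variables (k r : nat).

Section FormTriv.
Variables (E : M -> lmodType R) (t : trivialization r E) (x : M).

Definition form_map (w : altform (E x) k) : 'rV[R]_#|increasing k r| :=
  \row_a w (fun p => frame t x (multi_index a p)).

Lemma form_map_linear : linear form_map.
Proof. by move=> a u w; apply/rowP => i; rewrite !mxE. Qed.

HB.instance Definition _ := GRing.isLinear.Build R _ _ _ form_map form_map_linear.

Definition form_inv (y : 'rV[R]_#|increasing k r|) : altform (E x) k :=
  \sum_a y 0 a *: basis_form (triv_map t x) (multi_index a).
End FormTriv.

Definition form_triv (E : M -> lmodType R) (t : trivialization r E) :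
    trivialization #|increasing k r| (fun x => altform (E x) k) :=
  {| triv_dom := triv_dom t;
     triv_map := fun x => form_map t (x := x);
     triv_inv := form_inv t |}.

Definition forms (E : bundle r) : bundle #|increasing k r| :=
  {| fiber := fun x => altform (E x) k;
     trivs := [set form_triv t | t in trivs E] |}.
End Forms.

Definition dual_bundle r (E : bundle r) := forms 1 E.
Definition multivectors k r (E : bundle r) := dual_bundle (forms k E).

(* The anchor is a bundle map to TM, written as (x, v) |-> (f |-> rho(v)(f)).
   Only the values of the bracket on smooth sections matter. *)
Definition is_lie_algebroid r (E : bundle r)
    (rho : forall x, E x -> (M -> R) -> R)
    (br : section E -> section E -> section E) : Prop :=
  let S := @smooth_section r E in
  [/\ is_vector_bundle E,
      [/\ forall x v, is_tangent_vector x (rho x v),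
          forall x a u v f, smooth f ->
            rho x (a *: u + v) f = a * rho x u f + rho x v f
        & forall X f, S X -> smooth f -> smooth (fun x => rho x (X x) f)],
      [/\ forall X Y, S X -> S Y -> S (br X Y),
          forall a X Y Z, S X -> S Y -> S Z -> forall x,
            br (fun y => a *: X y + Y y) Z x = a *: br X Z x + br Y Z x
        & forall a X Y Z, S X -> S Y -> S Z -> forall x,
            br X (fun y => a *: Y y + Z y) x = a *: br X Y x + br X Z x],
      (forall X Y, S X -> S Y -> forall x, br X Y x = - br Y X x) /\
      (forall X Y Z, S X -> S Y -> S Z -> forall x,
         br X (br Y Z) x + br Y (br Z X) x + br Z (br X Y) x = 0)
    & forall X Y f, S X -> S Y -> smooth f -> forall x,
        br X (fun y => f y *: Y y) x = f x *: br X Y x + rho x (X x) f *: Y x].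

Record lie_algebroid r := LieAlgebroid {
  lie_bundle :> bundle r;
  anchor : forall x, lie_bundle x -> (M -> R) -> R;
  bracket : section lie_bundle -> section lie_bundle -> section lie_bundle;
  lie_algebroidP : is_lie_algebroid anchor bracket }.

Section Calculus.
Variables (r : nat) (A : lie_algebroid r).

Definition koszul k (w : section (forms k A)) (X : 'I_k.+1 -> section A) (x : M) : R :=
  \sum_(i < k.+1) (-1) ^+ i *
     anchor (X i x) (fun y => w y (fun p => X (lift i p) y)) +
  (* In the usual term for i < j, (-1)^(i+j) w([X_i,X_j],X_0,..^i..^j..,X_k),
     the bracket is moved to the place of X_i, at the cost of a sign (-1)^i;
     for i < j one has lift j i = i. *)
  \sum_(j < k.+1) \sum_(i < k | (i < j)%N) (-1) ^+ j *
     w x [eta (fun p => X (lift j p) x) with i |-> bracket (X (lift j i)) (X j) x].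

(* For smooth w the form z exists, by tensoriality of the Koszul formula, and is
   unique, as every vector of A x is the value at x of a smooth section. *)
Definition d_A k (w : section (forms k A)) : section (forms k.+1 A) :=
  fun x => xget 0 [set z : altform (A x) k.+1 |
    forall X : 'I_k.+1 -> section A, (forall i, smooth_section (X i)) ->
      z (fun i => X i x) = koszul w X x].

(* L_X = i_X d_A + d_A i_X, with i_X = 0 on functions. *)
Definition lie_derivative (X : section A) k :
    section (forms k A) -> section (forms k A) :=
  match k return section (forms k A) -> section (forms k A) with
  | 0 => fun w x => contract (X x) (d_A w x)
  | k'.+1 => fun w x => contract (X x) (d_A w x) +
                        d_A (fun y => contract (X y) (w y) : forms k' A y) x
  end.

End Calculus.

(* The rank m is written m'.+1, so that (m-1)-forms have degree m'. *)
Section Nambu.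
Variables (m' : nat) (A : lie_algebroid m'.+1).
Variable (Pi : section (multivectors m'.+1 A)).

Definition nambu_sharp (a : section (forms m' A)) : section A :=
  fun x => sharp (Pi x) (a x).

Definition nambu_anchor (x : M) (a : forms m' A x) : (M -> R) -> R :=
  anchor (sharp (Pi x) a).

Definition nambu_bracket (a b : section (forms m' A)) : section (forms m' A) :=
  fun x => lie_derivative (nambu_sharp a) b x +
           ((-1) ^+ m'.+1 * pairing (Pi x) (d_A a x)) *: b x.
End Nambu.

End Manifold.

Arguments forms {R n M} k {r} E.
Arguments multivectors {R n M} k {r} E.

(* Main.v *)
(* Let m be the rank of A, write rho(X)(f) as X(f), and let mu be a smooth m-form
   which is non-zero near a point.  Near that point every (m-1)-form is a
   contraction i_X mu.  Put f = Pi(mu).  Then Pi^#(i_X mu) = (-1)^(m-1) f X and, as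
   the space of m-forms on a fibre is a line, the terms L_X mu in the definition of
   the bracket cancel, which leaves
     [i_X mu, i_Y mu] = (-1)^(m-1) i_{X,Y} mu  with
     {X,Y} = f [X,Y] + X(f) Y - Y(f) X.
   The bracket {,} is visibly skew-symmetric, it satisfies a Leibniz rule for the
   anchor f rho, and it satisfies the Jacobi identity because rho is a morphism of
   brackets.  No division by f occurs, so the zeros of Pi do not matter.
   The existence of d_A w is the tensoriality of the Koszul formula, which follows by
   induction on the degree from Cartan's formula
   (d w)(X, U) = (L_X w)(U) - (d (i_X w))(U). *)

From HB Require Import structures.
From mathcomp Require Import all_boot all_order all_algebra all_fingroup.
From mathcomp Require Import all_classical all_reals all_analysis.
From mathcomp Require Import ring lra.
Require Import Defs.

Set Implicit Arguments.
Unset Strict Implicit.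
Unset Printing Implicit Defensive.

Import Order.TTheory GRing.Theory Num.Theory.
Import numFieldNormedType.Exports.

Local Open Scope classical_set_scope.
Local Open Scope ring_scope.

(** * Smooth functions and bump functions *)

(** Brackets, anchors and [d_A] act on sections and functions defined on all of M, and the axioms
    constrain them only on smooth ones. The form mu and the fields that represent forms as
    contractions of mu must therefore be cut off by bump functions, and a relation i_X mu = a
    survives only on a neighbourhood V of the chosen point. Hence the construction of smooth bump
    functions, the locality lemmas for the anchor, the bracket and the Koszul formula, and the
    choice of a new mu near each point. Two facts complete the cancellation in the bracket. First, d
    mu = 0 because its degree exceeds the rank, so d (i_X mu) = L_X mu. Second, df /\ mu = 0, which
    contracted with X and Y reads df /\ i_X i_Y mu = X(f) i_Y mu - Y(f) i_X mu; it is used in the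
    shape of Cramer's rule, on arguments. That rho is a morphism of brackets is not among the axioms
    of [is_lie_algebroid]; it is derived from the Jacobi identity and the Leibniz rule. *)

Lemma near_eq_differentiable (R : realType) (V W : normedModType R)
    (f g : V -> W) (y : V) :
  {near y, f =1 g} -> differentiable f y -> differentiable g y.
Proof.
move=> fg df.
have [dc dE] := (diff_locallyP y f).1 df.
have gE : g \o shift y = cst (g y) + 'd f y +o_0 id.
  apply/eqaddoP => e e0.
  have nE : \forall h \near (0 : V), f (h + y) = g (h + y).
    by rewrite (near_shift y) /= sub0r; apply: filterS fg => z zE; rewrite /= subrK.
  apply: filterS2 nE ((eqaddoP _ _ _ _).1 dE e e0) => h E.
  by rewrite /= !fctE /= E -(nbhs_singleton fg).
have dg : 'd g y = 'd f y :> (V -> W) by apply: diff_unique.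
by apply/diff_locallyP; rewrite dg.
Qed.

Section CkFunctions.
Variables (R : realType) (n : nat).
Implicit Types (f g : 'rV[R]_n -> R) (U V : set 'rV[R]_n).

Lemma Ck_sub k U V f : U `<=` V -> Ck k V f -> Ck k U f.
Proof.
elim: k f => [|k IH] f UV /=; first by move=> h y /UV /h.
by move=> [d h]; split => [y /UV /d //|i]; exact: IH (h i).
Qed.

(** V need not be open: [Ck] is a condition at each point of the set on the derivatives of one
    function defined everywhere. *)
Lemma Ck_local k U f :
  (forall y, U y -> exists2 V, V y & Ck k V f) -> Ck k U f.
Proof.
elim: k f => [|k IH] f h /=.
  by move=> y Uy; have [V Vy] := h y Uy; apply.
split=> [y Uy|i]; first by have [V Vy [d _]] := h y Uy; exact: d.
by apply: IH => y Uy; have [V Vy [_ d]] := h y Uy; exists V; last exact: d.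
Qed.

(** Openness makes f and g agree near each point of U, so that their directional derivatives agree
    on U too and the induction can continue. *)
Lemma Ck_ext k U f g : open U -> {in U, f =1 g} -> Ck k U f -> Ck k U g.
Proof.
move=> oU; elim: k f g => [|k IH] f g fg.
  move=> h y Uy; have fgy : f y = g y by apply: fg; rewrite inE.
  suff : g @ y --> g y by [].
  rewrite -fgy; apply: cvg_trans (h y Uy).
  apply: (@near_eq_cvg _ _ (nbhs y)).
  near=> z; apply: fg; rewrite inE.
  by near: z; apply: open_nbhs_nbhs.
have nfg y : U y -> {near y, f =1 g}.
  move=> Uy; near=> z; apply: fg; rewrite inE.
  by near: z; apply: open_nbhs_nbhs.
move=> [d h]; split=> [y Uy|i].
  exact: near_eq_differentiable (nfg y Uy) (d y Uy).
apply: IH (h i) => y; rewrite inE => Uy.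
exact/near_eq_derive/nfg.
Unshelve. all: by end_near. Qed.

Lemma Ck_pred k U f : Ck k.+1 U f -> Ck k U f.
Proof.
elim: k f => [|k IH] f.
  by move=> [d _] y Uy; apply/differentiable_continuous/d.
by move=> [d h]; split=> [//|i]; exact: IH (h i).
Qed.

Lemma Ck_cst k U (a : R) : Ck k U (fun=> a).
Proof.
elim: k a => [|k IH] a /=; first by move=> y _; exact: cst_continuous.
split=> [y _|i]; first exact: differentiable_cst.
have -> : (fun y : 'rV[R]_n => 'D_(delta_mx 0 i) (fun=> a : R) y) = (fun=> 0).
  by rewrite funeqE => y; exact: derive_cst.
exact: IH.
Qed.

Lemma CkD k U f g : open U -> Ck k U f -> Ck k U g ->
  Ck k U (fun y => f y + g y).
Proof.
move=> oU; elim: k f g => [|k IH] f g.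
  move=> hf hg y Uy; exact: (cvgD (hf y Uy) (hg y Uy)).
move=> [df hf] [dg hg]; split=> [y Uy|i].
  by apply: differentiableD; [exact: df|exact: dg].
apply: Ck_ext (IH _ _ (hf i) (hg i)) => // y; rewrite inE => Uy.
by rewrite -deriveD //; apply: diff_derivable; [exact: df|exact: dg].
Qed.

Lemma CkM k U f g : open U -> Ck k U f -> Ck k U g ->
  Ck k U (fun y => f y * g y).
Proof.
move=> oU; elim: k f g => [|k IH] f g.
  move=> hf hg y Uy; exact: (cvgM (hf y Uy) (hg y Uy)).
move=> hf' hg'; have [df hf] := hf'; have [dg hg] := hg'.
split=> [y Uy|i].
  by apply: differentiableM; [exact: df|exact: dg].
have := CkD oU (IH _ _ (Ck_pred hf') (hg i)) (IH _ _ (Ck_pred hg') (hf i)).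
apply: Ck_ext => // y; rewrite inE => Uy.
by rewrite -deriveM //; apply: diff_derivable; [exact: df|exact: dg].
Qed.

(* The recursion for the derivatives is that of x^-i e^(-1/x). *)
Lemma Ck_comp k U (h : nat -> R -> R) f :
  (forall i (x : R), is_derive x 1 (h i) (h i.+2 x - i%:R * h i.+1 x)) ->
  open U -> Ck k U f -> forall i, Ck k U (h i \o f).
Proof.
move=> hh oU; elim: k f => [|k IH] f hf i.
  move=> y Uy; apply: continuous_comp; first exact: hf.
  have /derivable1_diffP/differentiable_continuous : derivable (h i) (f y) 1.
    exact: ex_derive.
  exact.
have [df Df] := hf.
have dh j x : differentiable (h j) x by apply/derivable1_diffP; exact: ex_derive.
split=> [y Uy|j].
  by apply: differentiable_comp; [exact: df|exact: dh].
have Ck_f := Ck_pred hf.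
have H1 := CkD oU (IH f Ck_f i.+2) (CkM oU (Ck_cst k U (- i%:R)) (IH f Ck_f i.+1)).
apply: Ck_ext (CkM oU H1 (Df j)) => // y; rewrite inE => Uy.
rewrite [RHS]deriveE; last by apply: differentiable_comp; [exact: df|exact: dh].
rewrite diff_comp //=; last exact: df.
rewrite diff1E // derive1E derive_val -deriveE; last exact: df.
by rewrite /= mulNr mulrC.
Qed.

End CkFunctions.

(** * The flat functions x^-i exp (-1/x) *)

Section FlatFunctions.
Variable R : realType.
Implicit Types (x h : R) (i : nat).

(** The power of 1/x is a parameter because the derivatives of exp (-1/x) are combinations of these
    functions. *)
Definition flat i x : R := if 0 < x then x^-1 ^+ i * expR (- x^-1) else 0.

Lemma flat_le0 i x : x <= 0 -> flat i x = 0.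
Proof. by rewrite /flat; case: ltP. Qed.

Lemma flat0_gt0 x : 0 < x -> 0 < flat 0 x.
Proof. by move=> x0; rewrite /flat x0 expr0 mul1r expR_gt0. Qed.

(** With u = 1/h this is exp u >= u^(i+2) / (i+2)!, one term of the exponential series. The exponent
    2 of h is what makes the derivative at 0 vanish. *)
Lemma flat_bound i h : `|flat i h| <= i.+2`!%:R * h ^+ 2.
Proof.
have [h0|h0] := leP h 0.
  by rewrite flat_le0 // normr0 mulr_ge0 // sqr_ge0.
rewrite /flat h0; set u := h^-1; have u0 : 0 < u by rewrite invr_gt0.
rewrite ger0_norm; last by rewrite mulr_ge0 ?expR_ge0 // exprn_ge0 // ltW.
have E := expR_ge1Dxn i.+1 (ltW u0).
have {}E : u ^+ i.+2 / i.+2`!%:R <= expR u by apply: le_trans E; rewrite lerDr.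
have hu : h * u = 1 by rewrite mulfV ?gt_eqF.
have -> : u ^+ i = u ^+ i.+2 * h ^+ 2.
  by rewrite -addn2 exprD -mulrA -exprMn mulrC [u * h]mulrC hu expr1n mul1r.
rewrite mulrAC; apply: ler_wpM2r; first exact: sqr_ge0.
rewrite expRN ler_pdivrMr ?expR_gt0 //.
by move: E; rewrite ler_pdivrMr ?ltr0n ?fact_gt0 // mulrC.
Qed.

Lemma flat_is_derive i x : is_derive x 1 (flat i) (flat i.+2 x - i%:R * flat i.+1 x).
Proof.
have [x0|x0|->] := ltgtP x 0.
- rewrite !(flat_le0 _ (ltW x0)) mulr0 subr0.
  apply: (@near_eq_is_derive _ _ _ (cst 0)).
  near=> y; rewrite flat_le0 //; apply: ltW; near: y; exact: lt_nbhsl.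
- have xN : x != 0 by rewrite gt_eqF.
  have dV : is_derive x 1 (fun y : R => y^-1) (- x ^- 2).
    have := @is_deriveV R id x 1 1 xN (is_derive_id _ _).
    by rewrite /GRing.scale /= mulr1.
  have dN : is_derive x 1 (fun y : R => - y^-1) (x ^- 2).
    by have := is_deriveN dV; rewrite opprK.
  have dE := @is_derive1_comp R expR (fun y => - y^-1) x _ _ (is_derive_expR _) dN.
  have dM := is_deriveM (is_deriveX i dV) dE.
  apply: (@near_eq_is_derive _ _ _ ((fun y : R => y^-1) ^+ i * (expR \o (fun y => - y^-1)))).
    near=> y; rewrite /flat; have -> : 0 < y by near: y; exact: lt_nbhsr.
    by rewrite /= !fctE.
  apply: (@is_derive_eq _ _ _ _ _ _ _ _ dM); rewrite /flat x0 /GRing.scale /= !exprfctE.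
  case: i {dM} => [|i].
    by rewrite !(expr0, expr1, mul0r, mul1r, mulr0, addr0, subr0) exprVn mulrC.
  rewrite /= -!exprVn !exprS; ring.
- rewrite !(@flat_le0 _ 0) // mulr0 subr0.
  (* By [flat_bound] the difference quotient at 0 is at most (i+2)! |h|. *)
  have cv : h^-1 *: (flat i (h *: 1 + 0) - flat i 0) @[h --> 0^'] --> (0 : R).
    apply/cvgr0Pnorm_le => e e0.
    have F0 : 0 < i.+2`!%:R :> R by rewrite ltr0n fact_gt0.
    near=> h; rewrite (@flat_le0 _ 0) // subr0 addr0 /GRing.scale /= mulr1 normrM normfV.
    have h0 : 0 < `|h| by rewrite normr_gt0; near: h; exact: nbhs_dnbhs_neq.
    rewrite mulrC ler_pdivrMr //; apply: le_trans (flat_bound _ _) _.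
    rewrite -real_normK ?num_real // expr2 mulrA ler_pM2r //.
    rewrite mulrC -ler_pdivlMr //.
    near: h; apply: dnbhs0_le; exact: divr_gt0.
  apply: DeriveDef; first by apply/cvg_ex; exists 0.
  exact: cvg_lim cv.
Unshelve. all: by end_near. Qed.

End FlatFunctions.

(** * A smooth profile equal to 1 up to 1/2 and to 0 from 1 on *)

Section BumpProfile.
Variable R : realType.

(** [flat 0] is increasing on the positive half-line, so the outer argument is at most 0 for t <=
    1/2, and it equals [flat 0 2^-1] for t >= 1. Only compositions and a constant divisor occur, so
    smoothness requires no quotient rule. *)
Definition bump_profile (t : R) : R :=
  1 - flat 0 (flat 0 2^-1 - flat 0 (1 - t)) / flat 0 (flat 0 2^-1).

Lemma flat0_half_gt0 : 0 < flat 0 (2^-1 : R).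
Proof. by apply: flat0_gt0; rewrite invr_gt0. Qed.

Lemma bump_profile_le_half t : t <= 2^-1 -> bump_profile t = 1.
Proof.
move=> th; rewrite /bump_profile (@flat_le0 _ _ (_ - _)) ?mul0r ?subr0 //.
have t0 : 2^-1 <= 1 - t by lra.
have h0 : 0 < (2^-1 : R) by rewrite invr_gt0.
rewrite subr_le0 /flat h0 (lt_le_trans h0 t0) !expr0 !mul1r ler_expR lerN2.
by rewrite lef_pV2 // posrE // (lt_le_trans h0 t0).
Qed.

Lemma bump_profile_ge1 t : 1 <= t -> bump_profile t = 0.
Proof.
move=> t1; rewrite /bump_profile (@flat_le0 _ _ (1 - t)) ?subr_le0 // subr0 divff ?subrr //.
by rewrite gt_eqF // flat0_gt0 // flat0_half_gt0.
Qed.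

Lemma Ck_bump_profile n k (U : set 'rV[R]_n) f : open U -> Ck k U f -> Ck k U (bump_profile \o f).
Proof.
move=> oU hf.
have opp g : Ck k U g -> forall a, Ck k U (fun y => a - g y).
  move=> hg a; have := CkD oU (Ck_cst k U a) (CkM oU (Ck_cst k U (-1)) hg).
  by apply: Ck_ext => // y _; rewrite mulN1r.
have fl g : Ck k U g -> Ck k U (flat 0 \o g).
  by move=> hg; exact: (Ck_comp (@flat_is_derive R) oU hg).
have h1 := fl _ (opp _ (fl _ (opp _ hf 1)) (flat 0 2^-1)).
exact: opp _ (CkM oU h1 (Ck_cst k U (flat 0 (flat 0 2^-1))^-1)) 1.
Qed.

End BumpProfile.

(** * Smooth functions on a manifold *)

Section SmoothFunctions.
Variables (R : realType) (n : nat) (M : manifold R n).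
Implicit Types (W V : set M) (f g : M -> R).

Lemma open_chart_image (c : chart R n M) W :
  open W -> open (chart_map c @` (chart_dom c `&` W)).
Proof.
move=> oW; rewrite openE => _ [x [cx Wx] <-].
have cy : (chart_map c @` chart_dom c) (chart_map c x) by exists x.
have Wy : W (chart_inv c (chart_map c x)) by rewrite chart_mapK.
have nW : \forall z \near chart_map c x, W (chart_inv c z).
  by apply: (chart_inv_cont cy); exact: open_nbhs_nbhs.
have nD : \forall z \near chart_map c x, (chart_map c @` chart_dom c) z.
  by apply: open_nbhs_nbhs; split => //; exact: chart_im_open.
apply: filterS2 nW nD => z Wz [u cu uz]; exists u => //; split => //.
by rewrite -uz chart_mapK in Wz.
Qed.

Lemma smooth_onS W V f : W `<=` V -> smooth_on V f -> smooth_on W f.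
Proof.
move=> WV h c ac k; apply: Ck_sub (h c ac k) => _ [x [cx Wx] <-].
by exists x => //; split=> //; exact: WV.
Qed.

Lemma smooth_on_ext W f g : open W -> (forall x, W x -> f x = g x) ->
  smooth_on W f -> smooth_on W g.
Proof.
move=> oW fg h c ac k; apply: Ck_ext (h c ac k); first exact: open_chart_image.
by move=> y /[!inE] -[x [cx Wx] <-] /=; rewrite chart_mapK // fg.
Qed.

Lemma smooth_on_local W f :
  (forall x, W x -> exists V g,
     [/\ open V, V x, smooth_on V g & forall y, V y -> g y = f y]) ->
  smooth_on W f.
Proof.
move=> h c ac k; apply: Ck_local => _ [x [cx Wx] <-].
have [V [g [oV Vx sg gf]]] := h x Wx.
exists (chart_map c @` (chart_dom c `&` V)); first by exists x.
exact: (smooth_on_ext oV gf sg ac k).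
Qed.

Lemma smooth_on_cst W (a : R) : smooth_on W (fun=> a).
Proof. by move=> c _ k; exact: Ck_cst. Qed.

Lemma smooth_onD W f g : open W -> smooth_on W f -> smooth_on W g ->
  smooth_on W (fun x => f x + g x).
Proof.
move=> oW hf hg c ac k.
exact: (CkD (open_chart_image oW) (hf c ac k) (hg c ac k)).
Qed.

Lemma smooth_onM W f g : open W -> smooth_on W f -> smooth_on W g ->
  smooth_on W (fun x => f x * g x).
Proof.
move=> oW hf hg c ac k.
exact: (CkM (open_chart_image oW) (hf c ac k) (hg c ac k)).
Qed.

Lemma smooth_onN W f : open W -> smooth_on W f -> smooth_on W (fun x => - f x).
Proof.
move=> oW hf; apply: smooth_on_ext (smooth_onM oW (smooth_on_cst W (-1)) hf) => //.
by move=> x _; rewrite mulN1r.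
Qed.

Lemma smooth_onB W f g : open W -> smooth_on W f -> smooth_on W g ->
  smooth_on W (fun x => f x - g x).
Proof. by move=> oW hf hg; apply: smooth_onD => //; exact: smooth_onN. Qed.

Lemma smooth_on_sum W (I : Type) (s : seq I) (P : pred I) (F : I -> M -> R) :
  open W -> (forall i, P i -> smooth_on W (F i)) ->
  smooth_on W (fun x => \sum_(i <- s | P i) F i x).
Proof.
move=> oW h; elim: s => [|i s IH].
  apply: smooth_on_ext (smooth_on_cst W 0) => // x _.
  by rewrite big_nil.
have [Pi|Pi] := boolP (P i).
  apply: smooth_on_ext (smooth_onD oW (h i Pi) IH) => // x _.
  by rewrite big_cons Pi.
by apply: smooth_on_ext IH => // x _; rewrite big_cons (negbTE Pi).
Qed.

Lemma smooth_on_prod W (I : Type) (s : seq I) (P : pred I) (F : I -> M -> R) :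
  open W -> (forall i, P i -> smooth_on W (F i)) ->
  smooth_on W (fun x => \prod_(i <- s | P i) F i x).
Proof.
move=> oW h; elim: s => [|i s IH].
  apply: smooth_on_ext (smooth_on_cst W 1) => // x _.
  by rewrite big_nil.
have [Pi|Pi] := boolP (P i).
  apply: smooth_on_ext (smooth_onM oW (h i Pi) IH) => // x _.
  by rewrite big_cons Pi.
by apply: smooth_on_ext IH => // x _; rewrite big_cons (negbTE Pi).
Qed.

Lemma smooth_on_det W k (F : M -> 'I_k -> 'I_k -> R) : open W ->
  (forall p q, smooth_on W (fun x => F x p q)) ->
  smooth_on W (fun x => \det (\matrix_(p, q) F x p q)).
Proof.
move=> oW h.
have : smooth_on W (fun x => \sum_(s : 'S_k) (-1) ^+ s * \prod_i F x i (s i)).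
  apply: smooth_on_sum => // s _; apply: smooth_onM => //; first exact: smooth_on_cst.
  by apply: smooth_on_prod => // i _; exact: h.
apply: smooth_on_ext => // x _.
apply: eq_bigr => s _; congr (_ * _); apply: eq_bigr => i _; by rewrite mxE.
Qed.

(** The closed set K inside W serves to extend products by zero: an object defined on W only,
    multiplied by b, is smooth on W and vanishes on the open complement of K, and these two sets
    cover M. K is closed because it is the image of a compact box in a Hausdorff space. *)
Lemma bump_function W x0 : open W -> W x0 ->
  exists (b : M -> R) (K : set M),
    [/\ smooth b, closed K, K `<=` W, forall x, ~ K x -> b x = 0
      & \forall x \near x0, b x = 1].
Proof.
move=> oW Wx0; have [c ac cx0] := atlas_cover x0.
set y0 := chart_map c x0.
have : nbhs y0 (chart_map c @` (chart_dom c `&` W)).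
  by apply: open_nbhs_nbhs; split; [exact: open_chart_image|exists x0].
move=> /nbhs_ballP[e /= e0 he]; pose r := e / 2; have r0 : 0 < r by rewrite divr_gt0.
pose box := [set v : 'rV[R]_n | forall i, `[y0 0 i - r, y0 0 i + r]%classic (v ord0 i)].
have box_sub : box `<=` chart_map c @` (chart_dom c `&` W).
  apply: subset_trans he => v bv; split=> [|i j]; first exact: e0.
  rewrite -ball_normE /= (ord1 i) distrC; have := bv j.
  rewrite /= in_itv /= -ler_distl (ord1 ord0) => /le_lt_trans; apply.
  by rewrite ltr_pdivrMr // mulr_natr mulr2n ltrDl.
have box_compact := @rV_compact R n _ (fun i => @segment_compact R (y0 0 i - r) (y0 0 i + r)).
pose K := chart_inv c @` box.
have KW : K `<=` chart_dom c `&` W.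
  by move=> _ [v /box_sub[x [cx Wx] <-] <-]; rewrite chart_mapK.
have Kclosed : closed K.
  apply: compact_closed; first exact: manifold_hausdorff.
  have ci : {in box, continuous (chart_inv c)}.
    move=> v /[!inE] bv.
    by apply: chart_inv_cont; have [x [cx _] <-] := box_sub _ bv; exists x.
  exact: continuous_compact (continuous_in_subspaceT ci) box_compact.
(* A sum of squares is smooth, unlike the norm whose balls are boxes; outside the box a single term
   already reaches 1, where the profile vanishes. *)
pose t (z : 'rV[R]_n) := \sum_i ((z 0 i - y0 0 i) / r) ^+ 2.
pose b x := if `[< chart_dom c x >] then bump_profile (t (chart_map c x)) else 0.
have bK x : ~ K x -> b x = 0.
  rewrite /b; case: asboolP => // cx nK; apply: bump_profile_ge1.
  have /existsNP[i] : ~ box (chart_map c x).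
    by move=> bx; apply: nK; exists (chart_map c x) => //; rewrite chart_mapK.
  rewrite /= in_itv /= -ler_distl => /negP; rewrite -ltNge => ri.
  rewrite /t (bigD1 i) //= ler_wpDr ?sumr_ge0 // => [j _|]; first exact: sqr_ge0.
  rewrite -real_normK ?num_real // exprn_ege1 // normrM normfV (gtr0_norm r0).
  by rewrite ler_pdivlMr // mul1r ltW.
have Ck_t k (U : set 'rV[R]_n) (g : 'rV[R]_n -> M) : open U ->
    (forall i, Ck k U (fun y => chart_map c (g y) 0 i)) ->
    Ck k U (fun y => t (chart_map c (g y))).
  move=> oU hg; rewrite /t.
  have sum_Ck (s : seq 'I_n) : Ck k U (fun y => \sum_(i <- s)
      ((chart_map c (g y) 0 i - y0 0 i) / r) ^+ 2).
    elim: s => [|i s IH].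
      by apply: Ck_ext (Ck_cst k U 0) => // y _; rewrite big_nil.
    have h1 := CkM oU (CkD oU (hg i) (Ck_cst k U (- y0 0 i))) (Ck_cst k U r^-1).
    apply: Ck_ext (CkD oU (CkM oU h1 h1) IH) => // y _.
    by rewrite big_cons expr2.
  exact: sum_Ck.
exists b, K; split => //.
(* Two open sets suffice: the chart domain, where b is the profile in coordinates, and the
   complement of K, where b is 0. *)
- apply: smooth_on_local => x _; have [cx|ncx] := pselect (chart_dom c x).
    exists (chart_dom c), (fun x => bump_profile (t (chart_map c x))); split => //.
    + exact: chart_open.
    + move=> c' ac' k; have oU := @open_chart_image c' _ (@chart_open _ _ _ c).
      by apply: (Ck_bump_profile oU); apply: Ck_t => // i; exact: atlas_compatible.
    + by move=> y cy; rewrite /b; case: asboolP.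
  exists (~` K), (fun=> 0); split => //.
  + exact: closed_openC.
  + by move=> /KW[].
  + exact: smooth_on_cst.
  + by move=> y /bK ->.
- by move=> x /KW[].
have tc : {for x0, continuous (t \o chart_map c)}.
  apply: continuous_comp; first exact: chart_map_cont.
  have oC := @open_chart_image c _ (@chart_open _ _ _ c).
  have : Ck 0 (chart_map c @` (chart_dom c `&` chart_dom c))
    (fun y => t (chart_map c (chart_inv c y))).
    by apply: Ck_t => // i; exact: (atlas_compatible ac ac i 0).
  move=> /(Ck_ext oC (g := t)); apply; last by exists x0.
  by move=> _ /[!inE] -[x [cx _] <-]; rewrite chart_mapK.
have t0 : (t \o chart_map c) x0 < 2^-1.
  rewrite /= /t big1 ?invr_gt0 // => i _.
  by rewrite subrr mul0r expr0n.
have nt : \forall x \near x0, t (chart_map c x) < 2^-1.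
  exact: (tc _ (lt_nbhsl t0)).
have nc : \forall x \near x0, chart_dom c x.
  by apply: open_nbhs_nbhs; split=> //; exact: chart_open.
apply: filterS2 nt nc => x /ltW tx cx; rewrite /b.
by case: asboolP => // _; exact: bump_profile_le_half.
Qed.

End SmoothFunctions.

(** * Alternating forms *)

Lemma addr_idem_eq0 (V : zmodType) (x : V) : x = x + x -> x = 0.
Proof. by move=> /eqP; rewrite -subr_eq subrr eq_sym => /eqP. Qed.

Section Tuples.
Variable T : Type.

Definition upd k (v : 'I_k -> T) (i : 'I_k) (x : T) : 'I_k -> T :=
  fun p => if p == i then x else v p.

Lemma upd_same k (v : 'I_k -> T) i x : upd v i x i = x.
Proof. by rewrite /upd eqxx. Qed.

Lemma upd_id k (v : 'I_k -> T) i : upd v i (v i) = v.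
Proof. by apply/funext => p; rewrite /upd; case: eqP => [->|]. Qed.

Lemma upd_comp k (v : 'I_k -> T) (s : 'S_k) i x :
  upd (v \o s) i x = upd v (s i) x \o s.
Proof. by apply/funext => p; rewrite /upd /= (inj_eq perm_inj). Qed.

End Tuples.

Section AlternatingForms.
Variables (R : realType) (V : lmodType R).
Implicit Types (k : nat).

Lemma altform_eq k (w z : altform V k) : (forall v, w v = z v) -> w = z.
Proof. by move=> h; apply: val_inj; apply/funext. Qed.

Lemma altformD k (w z : altform V k) v : (w + z) v = w v + z v.
Proof. by []. Qed.

Lemma altformZ k a (w : altform V k) v : (a *: w) v = a * w v.
Proof. by []. Qed.

Lemma altform_sum k (I : Type) (s : seq I) (P : pred I) (F : I -> altform V k) v :
  (\sum_(i <- s | P i) F i) v = \sum_(i <- s | P i) F i v.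
Proof. by elim/big_rec2 : _ => // i y z _ <-. Qed.

Lemma alt_linear k (w : altform V k) v i a x y :
  w (upd v i (a *: x + y)) = a * w (upd v i x) + w (upd v i y).
Proof. by have [wM _] := altformP w; exact: wM. Qed.

Lemma alt_add k (w : altform V k) v i x y :
  w (upd v i (x + y)) = w (upd v i x) + w (upd v i y).
Proof. by rewrite -[x]scale1r alt_linear scale1r mul1r. Qed.

Lemma alt_upd0 k (w : altform V k) v i : w (upd v i 0) = 0.
Proof. by apply: (@addrI _ (w (upd v i 0))); rewrite -alt_add !addr0. Qed.

Lemma alt_scale k (w : altform V k) v i a x :
  w (upd v i (a *: x)) = a * w (upd v i x).
Proof. by rewrite -[a *: x]addr0 alt_linear alt_upd0 addr0. Qed.

Lemma alt_sum k (w : altform V k) v i (I : Type) (s : seq I) (P : pred I) (F : I -> V) :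
  w (upd v i (\sum_(j <- s | P j) F j)) = \sum_(j <- s | P j) w (upd v i (F j)).
Proof.
elim/big_rec2 : _ => [|j y z _ <-]; first exact: alt_upd0.
exact: alt_add.
Qed.

Lemma alt_eq0 k (w : altform V k) v i j : i != j -> v i = v j -> w v = 0.
Proof. by have [_ wA] := altformP w; exact: wA. Qed.

(** Polarization: w vanishes on the tuple with v i + v j at both places, and two of the four terms
    of its expansion vanish as well. *)
Lemma alt_tperm k (w : altform V k) v i j : i != j -> w (v \o tperm i j) = - w v.
Proof.
move=> ij; apply/eqP; rewrite -addr_eq0; apply/eqP.
have ji : j == i = false by rewrite eq_sym (negbTE ij).
pose u x y := upd (upd v i x) j y.
have z x : w (u x x) = 0.
  by apply: (alt_eq0 _ ij); rewrite /u /upd !eqxx (negbTE ij).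
have uC x y : u x y = upd (upd v j y) i x.
  apply/funext => p; rewrite /u /upd; case: eqP => // ->; by rewrite ji.
have := z (v i + v j); rewrite /u alt_add -/(u _ _) -/(u _ _) !uC !alt_add -!uC !z.
rewrite add0r addr0 => E; rewrite -[RHS]E; congr (w _ + w _); apply/funext => p.
  rewrite /u /upd /=; case: eqP => [->|/eqP pj]; first by rewrite tpermR.
  case: eqP => [->|/eqP pi]; first by rewrite tpermL.
  by rewrite tpermD // eq_sym.
by rewrite /u /upd; case: eqP => [->|_] //; case: eqP => [->|].
Qed.

Lemma alt_perm k (w : altform V k) v (s : 'S_k) : w (v \o s) = (-1) ^+ s * w v.
Proof.
have [ts -> dts] := prod_tpermP s; elim: ts dts v => [|[i j] ts IH] /= dts v.
  rewrite big_nil odd_perm1 mul1r; congr (w _); apply/funext => p /=; by rewrite perm1.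
have /andP[ij dts'] := dts.
rewrite big_cons odd_mul_tperm ij signr_addb expr1 mulN1r mulNr /=.
transitivity (w ((v \o (\prod_(t <- ts) tperm t.1 t.2)%g) \o tperm i j)).
  by congr (w _); apply/funext => p /=; rewrite permM.
by rewrite alt_tperm // IH.
Qed.

Lemma cons_arg0 k (x : V) (u : 'I_k -> V) : cons_arg x u ord0 = x.
Proof. by rewrite /cons_arg unlift_none. Qed.

Lemma cons_argS k (x : V) (u : 'I_k -> V) i : cons_arg x u (lift ord0 i) = u i.
Proof. by rewrite /cons_arg liftK. Qed.

(** [lift_perm ord0 j 1] is the cycle that moves place j to the front, of sign (-1)^j. *)
Lemma alt_move_front k (w : altform V k.+1) (u : 'I_k.+1 -> V) j x :
  w (cons_arg x (fun p => u (lift j p))) = (-1) ^+ j * w (upd u j x).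
Proof.
have -> : cons_arg x (fun p => u (lift j p)) = upd u j x \o lift_perm ord0 j 1.
  apply/funext => p /=; case: (unliftP ord0 p) => [q ->|->].
    by rewrite cons_argS lift_perm_lift perm1 /upd eq_sym (negbTE (neq_lift _ _)).
  by rewrite cons_arg0 lift_perm_id upd_same.
by rewrite alt_perm odd_lift_perm odd_perm1 addbF addFb signr_odd.
Qed.

Lemma contract_linear k (w : altform V k.+1) a x y :
  contract (a *: x + y) w = a *: contract x w + contract y w.
Proof.
apply: altform_eq => u; rewrite altformD altformZ /=.
rewrite /contract_fun.
have E z : cons_arg z u = upd (cons_arg 0 u) ord0 z.
  apply/funext => p; rewrite /upd; case: eqP => [->|]; first exact: cons_arg0.
  by case: (unliftP ord0 p) => [q -> _|-> //]; rewrite !cons_argS.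
by rewrite (E (a *: x + y)) (E x) (E y) alt_linear.
Qed.

Lemma contract0 k (w : altform V k.+1) : contract 0 w = 0.
Proof.
by have := contract_linear w 1 0 0; rewrite scaler0 addr0 scale1r => /addr_idem_eq0.
Qed.

Lemma contractD k (w : altform V k.+1) x y : contract (x + y) w = contract x w + contract y w.
Proof. by have := contract_linear w 1 x y; rewrite !scale1r. Qed.

Lemma contractZ k (w : altform V k.+1) a x : contract (a *: x) w = a *: contract x w.
Proof. by have := contract_linear w a x 0; rewrite contract0 !addr0. Qed.

Lemma contractN k (w : altform V k.+1) x : contract (- x) w = - contract x w.
Proof. by rewrite -scaleN1r contractZ scaleN1r. Qed.

End AlternatingForms.

(** * Coordinates on a vector space; [c] is injective and [e] is the basis it reads *)

Section Bases.
Variables (R : realType) (V : lmodType R) (r : nat).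
Variables (c : {linear V -> 'rV[R]_r}) (e : 'I_r -> V).
Hypothesis ce : forall i, c (e i) = delta_mx 0 i.
Hypothesis c_inj : injective c.

Lemma coord_basis i j : c (e i) 0 j = (i == j)%:R.
Proof. by rewrite ce mxE eqxx /= eq_sym. Qed.

Lemma basis_sum v : v = \sum_i c v 0 i *: e i.
Proof.
apply: c_inj; rewrite linear_sum [LHS]row_sum_delta.
by apply: eq_bigr => i _; rewrite linearZ ce.
Qed.

(** Arguments are expanded one at a time: in the induction, only the places below m may still hold
    something other than a basis vector. *)
Lemma alt_basis_eq0 k (w : altform V k) :
  (forall J : 'I_k -> 'I_r, w (e \o J) = 0) -> w = 0.
Proof.
move=> h.
have P m v : (forall p : 'I_k, (m <= p)%N -> exists i, v p = e i) -> w v = 0.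
  elim: m v => [|m IH] v hv.
    have /choice[J vJ] : forall p, exists i, v p = e i by move=> p; exact: hv.
    by have -> : v = e \o J by apply/funext.
  have [mk|km] := ltnP m k; last first.
    by apply: IH => p /(leq_trans km); rewrite leqNgt ltn_ord.
  pose q := Ordinal mk; rewrite -(upd_id v q) [v q]basis_sum alt_sum big1 // => i _.
  rewrite alt_scale IH ?mulr0 // => p mp; rewrite /upd.
  case: eqP => [_|/eqP pq]; first by exists i.
  by apply: hv; rewrite ltn_neqAle mp andbT eq_sym; exact: pq.
apply: altform_eq => v; apply: (P k) => p.
by rewrite leqNgt ltn_ord.
Qed.

End Bases.

(** * Increasing multi-indices *)

Section IncreasingTuples.
Variables (k r : nat).
Implicit Types (I J : {ffun 'I_k -> 'I_r}).

Lemma increasingP I :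
  reflect (forall p q : 'I_k, (p < q)%N -> (I p < I q)%N) (I \in increasing k r).
Proof.
rewrite inE; apply: (iffP forallP) => [h p q|h p].
  exact: implyP (forallP (h p) q).
by apply/forallP => q; apply/implyP; exact: h.
Qed.

Lemma multi_indexP (a : 'I_#|increasing k r|) (p q : 'I_k) :
  (p < q)%N -> (multi_index a p < multi_index a q)%N.
Proof. by move: p q; apply/increasingP; exact: enum_valP. Qed.

Lemma multi_index_inj (a : 'I_#|increasing k r|) : injective (multi_index a).
Proof.
move=> p q pq; apply: val_inj; case: (ltngtP p q) => //.
  by move=> /(multi_indexP a); rewrite pq ltnn.
by move=> /(multi_indexP a); rewrite pq ltnn.
Qed.

Lemma sorted_increasing I :
  (forall p q : 'I_k, (p < q)%N -> (I p < I q)%N) ->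
  sorted ltn [seq val (I p) | p <- enum 'I_k].
Proof.
move=> hI; rewrite sorted_map.
have : sorted (relpre val ltn) (enum 'I_k).
  by rewrite -sorted_map val_enum_ord iota_ltn_sorted.
by apply: sub_sorted => p q; exact: hI.
Qed.

(** An increasing tuple is the sorted list of its image, and an inclusion between two images of size
    k is an equality. *)
Lemma increasing_eq I J :
  (forall p q : 'I_k, (p < q)%N -> (I p < I q)%N) ->
  (forall p q : 'I_k, (p < q)%N -> (J p < J q)%N) ->
  (forall p, exists q, J p = I q) -> J = I.
Proof.
move=> hI hJ JI.
have sI := sorted_increasing hI; have sJ := sorted_increasing hJ.
have uI := sorted_uniq ltn_trans ltnn sI; have uJ := sorted_uniq ltn_trans ltnn sJ.
have sub : {subset [seq val (J p) | p <- enum 'I_k] <= [seq val (I p) | p <- enum 'I_k]}.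
  move=> _ /mapP[p _ ->]; have [q ->] := JI p.
  by apply/mapP; exists q => //; rewrite mem_enum.
have [|_ E] := uniq_min_size uJ sub; first by rewrite !size_map.
have {}E := irr_sorted_eq ltn_trans ltnn sJ sI E.
apply/ffunP => p; apply: val_inj.
have nthE (K : {ffun 'I_k -> 'I_r}) : nth 0%N [seq val (K q) | q <- enum 'I_k] p = K p.
  by rewrite (nth_map p) ?size_enum_ord // nth_ord_enum.
by rewrite -[LHS]nthE E nthE.
Qed.

Lemma injective_sort I : injective I -> exists (a : 'I_#|increasing k r|) (s : 'S_k),
  I =1 multi_index a \o s.
Proof.
move=> inj.
pose t := [tuple of [seq I p | p <- ord_tuple k]].
pose le := (fun i j : 'I_r => (i <= j)%N).
have le_tot : total le by move=> i j; exact: leq_total.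
have le_tr : transitive le by move=> i j l; exact: leq_trans.
have szt : size (sort le t) == k by rewrite size_sort size_tuple.
pose t' := Tuple szt.
have /tuple_permP[s ts] : perm_eq t t' by rewrite perm_sym /= perm_sort.
pose J := [ffun p => tnth t' p] : {ffun 'I_k -> 'I_r}.
have IJ p : I p = J (s p).
  transitivity (tnth t p); first by rewrite tnth_map tnth_ord_tuple.
  have tE : t = [tuple tnth t' (s i) | i < k] by apply: val_inj.
  by rewrite tE tnth_mktuple ffunE.
have Jinj : injective J.
  move=> p q; rewrite -(permKV s p) -(permKV s q) -!IJ => /inj E.
  by rewrite E.
have JP : J \in increasing k r.
  apply/increasingP => p q pq; rewrite ltn_neqAle; apply/andP; split.
    apply/eqP => /val_inj/Jinj E; by rewrite E ltnn in pq.
  rewrite !ffunE !(tnth_nth (I p)) /=.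
  have st : sorted le (sort le t) by exact: sort_sorted.
  apply: (sorted_ltn_nth le_tr (I p) st) => //; by rewrite inE (eqP szt).
exists (enum_rank_in JP J), s => p.
by rewrite IJ /= /multi_index enum_rankK_in.
Qed.

End IncreasingTuples.

Lemma increasing_id k (I : {ffun 'I_k -> 'I_k}) :
  (forall p q : 'I_k, (p < q)%N -> (I p < I q)%N) -> I =1 id.
Proof.
move=> hI; have E : I = [ffun p => p].
  apply: increasing_eq => //; first by move=> p q; rewrite !ffunE.
  by move=> p; exists (I p); rewrite ffunE.
by move=> p; rewrite E ffunE.
Qed.

(** By counting, the image misses some j, and [lift j] enumerates the complement of j in increasing
    order. *)
Lemma increasing_lift k (I : {ffun 'I_k -> 'I_k.+1}) :
  (forall p q : 'I_k, (p < q)%N -> (I p < I q)%N) -> 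
  exists j : 'I_k.+1, forall p, I p = lift j p.
Proof.
move=> hI.
have /subsetPn[j _ jI] : ~~ ([set: 'I_k.+1]%SET \subset I @: [set: 'I_k]%SET).
  apply/negP => /subset_leq_card; rewrite cardsT card_ord.
  move=> /leq_trans /(_ (leq_imset_card _ _)).
  by rewrite cardsT card_ord ltnn.
exists j => p.
have -> : I = [ffun p => lift j p].
  apply: increasing_eq => //.
    by move=> q q' qq'; rewrite !ffunE /= ltnNge leq_bump2 -ltnNge.
  move=> q; case: (unliftP j (I q)) => [q' E|E]; first by exists q'; rewrite ffunE.
  by move: jI; rewrite -E imset_f.
by rewrite ffunE.
Qed.

Section DualBases.
Variables (R : realType) (V : lmodType R) (r : nat).
Variables (c : {linear V -> 'rV[R]_r}) (e : 'I_r -> V).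
Hypothesis ce : forall i, c (e i) = delta_mx 0 i.
Hypothesis c_inj : injective c.

Lemma alt_increasing_eq k (w z : altform V k) :
  (forall a : 'I_#|increasing k r|, w (e \o multi_index a) = z (e \o multi_index a)) ->
  w = z.
Proof.
move=> h; apply/eqP; rewrite -subr_eq0; apply/eqP.
apply: (alt_basis_eq0 ce c_inj) => J.
have E u : (w - z) u = w u - z u by [].
have [/injectiveP inj|/injectivePn[p [q pq Jpq]]] := boolP (injectiveb [ffun p => J p]).
  have [a [s JE]] := injective_sort inj.
  have -> : e \o J = (e \o multi_index a) \o s.
    by apply/funext => p /=; rewrite -[J p](ffunE J) JE.
  by rewrite alt_perm E h subrr mulr0.
by rewrite (alt_eq0 _ pq) //=; move: Jpq; rewrite !ffunE => ->.
Qed.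

(** There is no injection of k indices into r < k, so no increasing tuple is left to test w on. This
    gives d mu = 0 for a form mu of top degree. *)
Lemma alt_high_degree k (w : altform V k) : (r < k)%N -> w = 0.
Proof.
move=> rk; apply: alt_increasing_eq => a.
by have := leq_card _ (multi_index_inj (a := a)); rewrite !card_ord leqNgt rk.
Qed.

Lemma basis_form_dual k (a b : 'I_#|increasing k r|) :
  basis_form c (multi_index b) (e \o multi_index a) = (a == b)%:R.
Proof.
rewrite /= /basis_form_fun; case: eqP => [->|ab].
  rewrite [X in \det X](_ : _ = 1%:M) ?det1 //; apply/matrixP => p q.
  by rewrite !mxE coord_basis // (inj_eq (@multi_index_inj _ _ _)) eq_sym.
(* Distinct increasing tuples have distinct images; an index of b that is missing from a gives a
   zero row of the matrix. *)
have [p hp] : exists p, forall q, multi_index b p <> multi_index a q.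
  apply/not_existsP => h; apply: ab; apply: enum_val_inj; apply/esym.
  apply: (increasing_eq (@multi_indexP _ _ a) (@multi_indexP _ _ b)) => p.
  by have /existsNP[q /contrapT] := h p; exists q.
rewrite (expand_det_row _ p) big1 // => q _; rewrite mxE coord_basis //.
by case: eqP => [E|]; [case: (hp q)|rewrite mul0r].
Qed.

Lemma alt_basis_expansion k (w : altform V k) :
  w = \sum_a w (e \o multi_index a) *: basis_form c (multi_index a).
Proof.
apply: alt_increasing_eq => a; rewrite altform_sum (bigD1 a) // altformZ.
rewrite basis_form_dual eqxx mulr1 big1 ?Monoid.mulm1 // => b ba.
by rewrite altformZ basis_form_dual eq_sym (negbTE ba) mulr0.
Qed.

Lemma one_form_eq (x y : V) :
  (forall b : altform V 1, b (fun=> x) = b (fun=> y)) -> x = y.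
Proof.
move=> h; apply: c_inj; apply/rowP => i.
by have := h (basis_form c (fun=> i)); rewrite /= /basis_form_fun !det_mx11 !mxE.
Qed.

End DualBases.

(** The left side does not depend on i, so it can be summed over all i: each permutation then
    contributes the full sum of F, and (m+1)! / (m+1) = m!. *)
Lemma sum_perm_eval (R : numFieldType) m (F : 'I_m.+1 -> R) (i : 'I_m.+1) :
  \sum_(s : 'S_m.+1) F (s i) = m`!%:R * \sum_j F j.
Proof.
have E k : \sum_(s : 'S_m.+1) F (s k) = \sum_(s : 'S_m.+1) F (s i).
  rewrite (reindex_inj (mulgI (tperm i k))) /=.
  by apply: eq_bigr => s _; rewrite permM tpermR.
have nz : m.+1%:R != 0 :> R by rewrite pnatr_eq0.
apply: (mulfI nz); rewrite mulrA -natrM -factS.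
transitivity (\sum_(k < m.+1) \sum_(s : 'S_m.+1) F (s k)).
  under [RHS]eq_bigr => k _ do rewrite E.
  by rewrite sumr_const card_ord mulr_natl.
rewrite exchange_big /= (eq_bigr (fun=> \sum_j F j)) => [|s _].
  by rewrite sumr_const card_Sn mulr_natl.
by rewrite [RHS](reindex_inj (@perm_inj _ s)).
Qed.

Lemma odd_cast_perm m n (E : m = n) (s : 'S_m) : cast_perm E s = s :> bool.
Proof. by subst n; rewrite cast_perm_id. Qed.

(** * Forms of top degree and Cramer's rule *)

Section TopForms.
Variables (R : realType) (V : lmodType R) (r : nat).
Variables (c : {linear V -> 'rV[R]_r}) (e : 'I_r -> V).
Hypothesis ce : forall i, c (e i) = delta_mx 0 i.
Hypothesis c_inj : injective c.

Lemma top_form_eq (w z : altform V r) : w e = z e -> w = z.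
Proof.
move=> E; apply: (alt_increasing_eq ce c_inj) => a.
suff -> : e \o multi_index a = e by [].
by apply/funext => p /=; rewrite (increasing_id (@multi_indexP _ _ a)).
Qed.

Lemma det_form_basis : basis_form c id e = 1.
Proof.
rewrite /= /basis_form_fun [X in \det X](_ : _ = 1%:M) ?det1 //.
by apply/matrixP => p q; rewrite !mxE (coord_basis ce) eq_sym.
Qed.

Lemma top_formE (w : altform V r) : w = w e *: basis_form c id.
Proof. by apply: top_form_eq; rewrite altformZ det_form_basis mulr1. Qed.

(** Cramer's rule det(u) v = sum_j det(u with v at place j) u_j, to which b is applied; C adj(C) =
    det C avoids dividing, so u may be degenerate. As b is any linear function, the rule serves both
    for a 1-form and for v |-> rho(v)(f). *)
Lemma top_form_cramer (w : altform V r) u v (b : V -> R) :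
  (forall a x y, b (a *: x + y) = a * b x + b y) ->
  \sum_j w (upd u j v) * b (u j) = w u * b v.
Proof.
move=> blin.
have b0 : b 0 = 0.
  by have := blin 1 0 0; rewrite scaler0 addr0 mul1r => /addr_idem_eq0.
have bE x : b x = \sum_q c x 0 q * b (e q).
  rewrite {1}(basis_sum ce c_inj x).
  by elim/big_rec2 : _ => // i y z _ <-; rewrite blin.
rewrite (top_formE w); set a := w e.
pose C := \matrix_(p, q) c (u q) 0 p.
(* Expansion along column j; the cofactors do not see the vector put there, so they are those of
   C. *)
have DE j : basis_form c id (upd u j v) = \sum_p c v 0 p * (\adj C) j p.
  rewrite /= /basis_form_fun (expand_det_col _ j); apply: eq_bigr => p _.
  rewrite mxE upd_same; congr (_ * _); rewrite mxE /cofactor; congr (_ * \det _).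
  by apply/matrixP => x y; rewrite !mxE /upd eq_sym (negbTE (neq_lift _ _)).
transitivity (\sum_p \sum_q a * (c v 0 p * b (e q)) * (C *m \adj C) q p).
  under eq_bigr => j _ do rewrite altformZ DE bE -mulrA mulr_suml mulr_sumr.
  rewrite exchange_big /=; apply: eq_bigr => p _.
  under eq_bigr => j _ do rewrite !mulr_sumr.
  rewrite exchange_big /=; apply: eq_bigr => q _.
  rewrite [in RHS]mxE mulr_sumr; apply: eq_bigr => j _; rewrite [C q j]mxE; ring.
rewrite mul_mx_adj altformZ (bE v) mulr_sumr; apply: eq_bigr => p _.
rewrite (bigD1 p) //= big1 => [|q qp]; last by rewrite !mxE (negbTE qp) mulr0.
by rewrite mxE eqxx mulr1n addr0 /= /basis_form_fun -/C; ring.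
Qed.

Lemma pairing_linear k (P : altform (altform V k) 1) a w z :
  pairing P (a *: w + z) = a * pairing P w + pairing P z.
Proof.
have E (t : altform V k) : (fun=> t) = upd (fun=> 0) ord0 t :> ('I_1 -> altform V k).
  by apply/funext => i; rewrite /upd !ord1 eqxx.
by rewrite /pairing (E (a *: w + z)) (E w) (E z) alt_linear.
Qed.

Lemma pairing_scale k (P : altform (altform V k) 1) a w :
  pairing P (a *: w) = a * pairing P w.
Proof.
have P0 : pairing P 0 = 0.
  have := pairing_linear P 1 0 0.
  by rewrite scaler0 addr0 mul1r => /addr_idem_eq0.
by rewrite -[a *: w]addr0 pairing_linear P0 addr0.
Qed.

(** Both sides are bilinear in w and z, and on a line such expressions are symmetric. In the bracket
    it exchanges Pi(d a) mu for Pi(mu) d a. *)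
Lemma top_pairing_comm (P : altform (altform V r) 1) w z :
  pairing P z *: w = pairing P w *: z.
Proof.
rewrite (top_formE w) (top_formE z) !pairing_scale !scalerA.
by congr (_ *: _); ring.
Qed.

End TopForms.

(** * Contractions of a top form and the map [sharp] *)

Section TopContraction.
Variables (R : realType) (V : lmodType R) (m : nat).
Variables (c : {linear V -> 'rV[R]_m.+1}) (e : 'I_m.+1 -> V).
Hypothesis ce : forall i, c (e i) = delta_mx 0 i.
Hypothesis c_inj : injective c.

(** An explicit inverse of X |-> i_X w. Its linear dependence on the values of a later gives
    representing fields that are smooth and linear in a. *)
Lemma contract_top_form (w : altform V m.+1) (a : altform V m) : w e = 1 ->
  contract (\sum_(i < m.+1) ((-1) ^+ i * a (fun p => e (lift i p))) *: e i) w = a.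
Proof.
move=> we; apply: (alt_increasing_eq ce c_inj) => J.
have [j Jj] := increasing_lift (@multi_indexP _ _ J).
have -> : e \o multi_index J = fun p => e (lift j p).
  by apply/funext => p; rewrite /= Jj.
rewrite /= /contract_fun alt_move_front alt_sum (bigD1 j) //= alt_scale upd_id we.
rewrite mulr1 big1 ?addr0 => [|i ij].
  by rewrite mulrA -expr2 sqrr_sign mul1r.
rewrite alt_scale (@alt_eq0 _ _ _ w _ i j ij) ?mulr0 //.
by rewrite upd_same /upd (negbTE ij).
Qed.

(** In the sum defining the wedge product, the term of s depends only on the image of the last
    place, so m! equal terms absorb the normalization; the remaining sum over that image is Cramer's
    rule. *)
Lemma wedge_contract (E : (m + 1)%N = m.+1) (w : altform V m.+1) v (b : altform V 1) :
  wedge E (contract v w) b = ((-1) ^+ m * b (fun=> v)) *: w.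
Proof.
apply: altform_eq => u; rewrite altformZ /= /wedge_fun.
have blin a x y : b (fun=> a *: x + y) = a * b (fun=> x) + b (fun=> y).
  have F (t : V) : (fun=> t) = upd (fun=> 0) ord0 t :> ('I_1 -> V).
    by apply/funext => i; rewrite /upd !ord1 eqxx.
  by rewrite (F (a *: x + y)) (F x) (F y) alt_linear.
transitivity (m`!%:R^-1 * \sum_(s : 'S_m.+1)
  (-1) ^+ m * (w (upd u (s ord_max) v) * b (fun=> u (s ord_max)))).
  rewrite muln1; congr (_ * _).
  have bij : bijective (@cast_perm _ _ (esym E)).
    by exists (cast_perm E) => s; rewrite ?cast_permK ?cast_permKV.
  rewrite (reindex _ (onW_bij _ bij)) /=; apply: eq_bigr => s _.
  have oddE : odd_perm (cast_perm (esym E) s) = odd_perm s by rewrite odd_cast_perm.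
  rewrite oddE /contract_fun.
  have uE i : u (cast_ord E (cast_perm (esym E) s i)) = u (s (cast_ord E i)).
    by rewrite cast_permE esymK cast_ordKV.
  have -> : (fun i : 'I_m => u (cast_ord E (cast_perm (esym E) s (lshift 1 i)))) =
            (fun i => (u \o s) (lift ord_max i)).
    apply/funext => i; rewrite uE /=; congr (u (s _)); apply: val_inj => /=.
    by rewrite /bump leqNgt ltn_ord.
  have -> : (fun j : 'I_1 => u (cast_ord E (cast_perm (esym E) s (rshift m j)))) =
            (fun=> u (s ord_max)).
    apply/funext => i; rewrite uE /=; congr (u (s _)); apply: val_inj => /=.
    by rewrite ord1 addn0.
  (* Moving v from the front to the omitted last place costs (-1)^m; sorting by s costs a second
     sign of s, which cancels the first. *)
  rewrite alt_move_front upd_comp alt_perm /=.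
  by rewrite !mulrA; congr (_ * _ * _); rewrite mulrAC -expr2 sqrr_sign mul1r.
rewrite (sum_perm_eval (fun j => (-1) ^+ m * (w (upd u j v) * b (fun=> u j)))).
rewrite mulKf ?pnatr_eq0 -?lt0n ?fact_gt0 // -mulr_sumr.
rewrite (top_form_cramer ce c_inj w u v (b := fun x => b (fun=> x))) //; ring.
Qed.

Lemma sharp_contract (P : altform (altform V m.+1) 1) (w : altform V m.+1) v :
  sharp P (contract v w) = ((-1) ^+ m * pairing P w) *: v.
Proof.
have hx (b : altform V 1) :
    b (fun=> ((-1) ^+ m * pairing P w) *: v) =
    pairing (interior (addn1 m) (contract v w) P) b.
  rewrite {2}/pairing /= /interior_fun wedge_contract pairing_scale.
  have F (t : V) : (fun=> t) = upd (fun=> 0) ord0 t :> ('I_1 -> V).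
    by apply/funext => i; rewrite /upd !ord1 eqxx.
  by rewrite (F (_ *: v)) alt_scale -F; ring.
(* The candidate of [hx] excludes the default value of [xget], and 1-forms separate vectors, so the
   chosen vector is the candidate. *)
rewrite /sharp /vector_of; case: xgetP => [x _ xP|/(_ _ hx)//].
by apply: (one_form_eq c_inj) => b; rewrite hx xP.
Qed.

End TopContraction.

(** * Sections of vector bundles *)

Section Sections.
Variables (R : realType) (n : nat) (M : manifold R n) (r : nat) (E : bundle M r).
Hypothesis hE : is_vector_bundle E.
Implicit Types (X Y s : section E) (t : trivialization r E).

Lemma triv_open t : trivs t -> open (triv_dom t).
Proof. by have [h _ _] := hE; move=> /h[]. Qed.

Lemma triv_map_frame t x i : trivs t -> triv_dom t x ->
  triv_map t x (frame t x i) = delta_mx 0 i.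
Proof. by have [h _ _] := hE; move=> /h[_ _ c] /c ->. Qed.

Lemma triv_map_inj t x : trivs t -> triv_dom t x -> injective (triv_map t x).
Proof. by have [h _ _] := hE; move=> /h[_ c _] /c /can_inj. Qed.

Lemma smooth_section_linear f X Y : smooth f -> smooth_section X ->
  smooth_section Y -> smooth_section (fun x => f x *: X x + Y x : E x).
Proof.
move=> hf hX hY t tE i; have oW := triv_open tE.
have hf' : smooth_on (triv_dom t) f by apply: smooth_onS hf.
apply: smooth_on_ext (smooth_onD oW (smooth_onM oW hf' (hX t tE i)) (hY t tE i)) => // x _.
by rewrite linearP !mxE.
Qed.

Lemma smooth_section0 : smooth_section (fun x => 0 : E x).
Proof.
move=> t tE i; apply: smooth_on_ext (smooth_on_cst _ 0) => [|x _]; first exact: triv_open.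
by rewrite linear0 mxE.
Qed.

Lemma smooth_sectionZ f X : smooth f -> smooth_section X ->
  smooth_section (fun x => f x *: X x : E x).
Proof.
move=> hf hX; have := smooth_section_linear hf hX smooth_section0.
by congr smooth_section; apply: functional_extensionality_dep => x; rewrite addr0.
Qed.

Lemma smooth_sectionD X Y : smooth_section X -> smooth_section Y ->
  smooth_section (fun x => X x + Y x : E x).
Proof.
move=> hX hY; have := smooth_section_linear (smooth_on_cst setT 1) hX hY.
by congr smooth_section; apply: functional_extensionality_dep => x; rewrite scale1r.
Qed.

Lemma smooth_section_sum (I : Type) (l : seq I) (F : I -> section E) :
  (forall i, smooth_section (F i)) ->
  smooth_section (fun x => \sum_(i <- l) F i x : E x).
Proof.
move=> hF; elim: l => [|i l IH].
  have := smooth_section0; congr smooth_section.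
  by apply: functional_extensionality_dep => x; rewrite big_nil.
have := smooth_sectionD (hF i) IH; congr smooth_section.
by apply: functional_extensionality_dep => x; rewrite big_cons.
Qed.

Lemma smooth_section_local s :
  (forall x, exists V s', [/\ open V, V x, smooth_section s' &
     forall y, V y -> s' y = s y]) -> smooth_section s.
Proof.
move=> h t tE i; apply: smooth_on_local => x tx.
have [V [s' [oV Vx hs' ss']]] := h x.
have oW : open (V `&` triv_dom t) by apply: openI => //; exact: triv_open.
exists (V `&` triv_dom t), (fun x => triv_map t x (s' x) 0 i); split => //.
- exact: smooth_onS (hs' t tE i).
- by move=> y [Vy _]; rewrite ss'.
Qed.

Lemma smooth_bump_frame t (b : M -> R) (K : set M) i : trivs t ->
  smooth b -> closed K -> K `<=` triv_dom t -> (forall x, ~ K x -> b x = 0) ->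
  smooth_section (fun x => b x *: frame t x i : E x).
Proof.
move=> tE hb cK KW bK t' tE' j; have [_ _ trans] := hE.
apply: smooth_on_local => x tx'; have oW' := triv_open tE'.
have [tx|ntx] := pselect (triv_dom t x).
  have oW : open (triv_dom t `&` triv_dom t') by apply: openI => //; exact: triv_open.
  exists (triv_dom t `&` triv_dom t').
  exists (fun x => b x * triv_map t' x (frame t x i) 0 j); split => //.
  - apply: smooth_onM => //; first by apply: smooth_onS hb.
    exact: trans.
  - by move=> y _; rewrite linearZ mxE.
exists (~` K), (fun=> 0); split => //.
- exact: closed_openC.
- by move=> /KW.
- exact: smooth_on_cst.
- by move=> y /bK ->; rewrite scale0r linear0 mxE.
Qed.

(** The sections [e i] are global and smooth, but they form a frame only where b is non-zero, and
    coincide with the frame of t on V. *)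
Lemma local_frame x0 : exists (t : trivialization r E) (b : M -> R) (e : 'I_r -> section E),
  [/\ trivs t, triv_dom t x0, forall i, smooth_section (e i),
      forall i x, e i x = b x *: frame t x i &
      [/\ smooth b, exists K, [/\ closed K, K `<=` triv_dom t & forall x, ~ K x -> b x = 0] &
      exists V : set M, [/\ open V, V x0, V `<=` triv_dom t & forall x, V x -> b x = 1]]].
Proof.
have [_ cov _] := hE; have [t tE tx0] := cov x0.
have [b [K [hb cK KW bK b1]]] := bump_function (triv_open tE) tx0.
exists t, b, (fun i x => b x *: frame t x i); split => //.
  by move=> i; exact: smooth_bump_frame KW bK.
split => //; first by exists K.
have : nbhs x0 [set x | b x = 1 /\ triv_dom t x].
  by apply: filterI b1 _; apply: open_nbhs_nbhs; split => //; exact: triv_open.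
rewrite nbhsE => -[V [oV Vx0] VP]; exists V; split => // x /VP[] //.
Qed.

(** The extension is linear in v at every point y, and not only at x0, so that a multilinear
    expression in sections yields one in vectors of the fibre. *)
Lemma section_extension x0 : exists ext : E x0 -> section E,
  [/\ forall v, smooth_section (ext v), forall v, ext v x0 = v
    & forall a u v y, ext (a *: u + v) y = a *: ext u y + ext v y].
Proof.
have [t [b [e [tE tx0 he eE [hb _ [V [oV Vx0 VW b1]]]]]]] := local_frame x0.
exists (fun v y => \sum_i triv_map t x0 v 0 i *: e i y); split.
- move=> v; apply: smooth_section_sum => i.
  by apply: smooth_sectionZ => //; exact: smooth_on_cst.
- move=> v; rewrite [RHS](basis_sum (fun i => triv_map_frame i tE tx0) (triv_map_inj tE tx0)).
  by apply: eq_bigr => i _; rewrite eE b1 // scale1r.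
- move=> a u v y; rewrite scaler_sumr -big_split /=; apply: eq_bigr => i _.
  by rewrite linearP !mxE scalerDl scalerA.
Qed.

Section Forms.
Variable k : nat.

Lemma form_frame t x a : frame (form_triv k t) x a = basis_form (triv_map t x) (multi_index a).
Proof.
rewrite /frame /= /form_inv (bigD1 a) //= mxE !eqxx scale1r big1 ?addr0 // => b ba.
by rewrite mxE eqxx (negbTE ba) scale0r.
Qed.

(** The transition functions are minors of the transition matrices of E, taken in the opposite
    direction. *)
Lemma forms_vector_bundle : is_vector_bundle (forms k E).
Proof.
have [h cov trans] := hE; split.
- move=> _ [t tE <-]; split; first exact: triv_open.
  + move=> x tx w; rewrite /= /form_inv.
    rewrite [RHS](alt_basis_expansion (fun i => triv_map_frame i tE tx) (triv_map_inj tE tx)).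
    by apply: eq_bigr => a _; rewrite mxE.
  + move=> x tx y; apply/rowP => a; rewrite /= mxE /form_inv.
    rewrite altform_sum (bigD1 a) // altformZ.
    have ce i := triv_map_frame i tE tx.
    rewrite (basis_form_dual ce) eqxx mulr1 big1 ?Monoid.mulm1 // => b ba.
    by rewrite altformZ (basis_form_dual ce) eq_sym (negbTE ba) mulr0.
- move=> x; have [t tE tx] := cov x.
  by exists (form_triv k t) => //; exists t.
- move=> _ _ [t tE <-] [t' tE' <-] a a'.
  have oW : open (triv_dom t `&` triv_dom t') by apply: openI; exact: triv_open.
  apply: (@smooth_on_ext _ _ _ _ (fun x => \det (\matrix_(p, q)
    triv_map t x (frame t' x (multi_index a' q)) 0 (multi_index a p)))) => //.
    by move=> x _; rewrite form_frame /= mxE.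
  apply: smooth_on_det => // p q.
  by rewrite setIC; exact: trans.
Qed.

Lemma smooth_form_eval (w : section (forms k E)) (U : 'I_k -> section E) :
  smooth_section w -> (forall i, smooth_section (U i)) ->
  smooth (fun x => w x (fun i => U i x)).
Proof.
move=> hw hU; have [h cov trans] := hE.
apply: smooth_on_local => x _; have [t tE tx] := cov x; have oW := triv_open tE.
exists (triv_dom t), (fun x => \sum_a form_map t (w x) 0 a *
  \det (\matrix_(p, q) triv_map t x (U q x) 0 (multi_index a p))); split => //.
  apply: smooth_on_sum => // a _; apply: smooth_onM => //.
    by apply: (hw (form_triv k t)); exists t.
  by apply: smooth_on_det => // p q; exact: hU.
move=> y ty; have ce i := triv_map_frame i tE ty.
rewrite [in RHS](alt_basis_expansion ce (triv_map_inj tE ty) (w y)).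
by rewrite altform_sum; apply: eq_bigr => a _; rewrite mxE.
Qed.

Lemma smooth_form_of_eval (w : section (forms k E)) :
  (forall U : 'I_k -> section E, (forall i, smooth_section (U i)) ->
     smooth (fun x => w x (fun i => U i x))) -> smooth_section w.
Proof.
move=> h _ [t tE <-] a; apply: smooth_on_local => x /= tx.
have [b [K [hb cK KW bK b1]]] := bump_function (triv_open tE) tx.
have : nbhs x [set y | b y = 1 /\ triv_dom t y].
  by apply: filterI b1 _; apply: open_nbhs_nbhs; split => //; exact: triv_open.
rewrite nbhsE => -[V [oV Vx] VP].
exists V, (fun x => w x (fun i => b x *: frame t x (multi_index a i))); split => //.
  apply: smooth_onS (h (fun i x => b x *: frame t x (multi_index a i)) _) => //.
  by move=> i; exact: smooth_bump_frame KW bK.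
move=> y /VP[by1 ty]; rewrite mxE; congr (w y _); apply/funext => i.
by rewrite by1 scale1r.
Qed.

End Forms.

End Sections.

Section ConsTuple.
Variable T : Type.

(* [cons_arg] for an arbitrary type: sections are not given a module structure. *)
Definition tcons k (x : T) (u : 'I_k -> T) (i : 'I_k.+1) : T :=
  if unlift ord0 i is Some j then u j else x.

Lemma tcons0 k (x : T) (u : 'I_k -> T) : tcons x u ord0 = x.
Proof. by rewrite /tcons unlift_none. Qed.

Lemma tconsS k (x : T) (u : 'I_k -> T) i : tcons x u (lift ord0 i) = u i.
Proof. by rewrite /tcons liftK. Qed.

Lemma tcons_eta k (u : 'I_k.+1 -> T) : u = tcons (u ord0) (fun i => u (lift ord0 i)).
Proof.
by apply/funext => i; case: (unliftP ord0 i) => [j ->|->]; rewrite ?tconsS ?tcons0.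
Qed.

Lemma lift_lift0 k (i : 'I_k.+1) (p : 'I_k) :
  lift (lift ord0 i) (lift ord0 p) = lift ord0 (lift i p).
Proof. by apply: val_inj; rewrite /= /bump /= !add1n ltnS addnS. Qed.

Lemma lift_lift00 k (i : 'I_k.+1) : lift (lift ord0 i) ord0 = ord0 :> 'I_k.+2.
Proof. by apply: val_inj. Qed.

Lemma tcons_lift k (x : T) (u : 'I_k.+1 -> T) i :
  (fun p => tcons x u (lift (lift ord0 i) p)) = tcons x (fun p => u (lift i p)).
Proof.
apply/funext => p; case: (unliftP ord0 p) => [q ->|->].
  by rewrite lift_lift0 !tconsS.
by rewrite lift_lift00 !tcons0.
Qed.

Lemma tcons_upd k (x : T) (u : 'I_k -> T) i y :
  tcons x (upd u i y) = upd (tcons x u) (lift ord0 i) y.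
Proof.
apply/funext => p; case: (unliftP ord0 p) => [q ->|->].
  by rewrite tconsS /upd (inj_eq (@lift_inj _ _)) tconsS.
by rewrite tcons0 /upd (negbTE (neq_lift _ _)) tcons0.
Qed.

Lemma tcons_upd0 k (x : T) (u : 'I_k -> T) y : upd (tcons x u) ord0 y = tcons y u.
Proof.
apply/funext => p; rewrite /upd; case: (unliftP ord0 p) => [q ->|->].
  by rewrite eq_sym (negbTE (neq_lift _ _)) !tconsS.
by rewrite eqxx tcons0.
Qed.

Lemma tcons_perm k (x : T) (u : 'I_k -> T) (s : 'S_k) :
  tcons x u \o lift_perm ord0 ord0 s = tcons x (u \o s).
Proof.
apply/funext => p /=; case: (unliftP ord0 p) => [q ->|->].
  by rewrite lift_perm_lift !tconsS.
by rewrite lift_perm_id !tcons0.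
Qed.

Lemma tcons_swap k (x y : T) (u : 'I_k -> T) :
  tcons x (tcons y u) \o tperm ord0 (lift ord0 ord0) = tcons y (tcons x u).
Proof.
apply/funext => p /=; case: (unliftP ord0 p) => [q ->|->]; last first.
  by rewrite tpermL tconsS !tcons0.
case: (unliftP ord0 q) => [q' ->|->]; last by rewrite tpermR tconsS !tcons0.
by rewrite tpermD ?tconsS // (inj_eq (@lift_inj _ _)) neq_lift.
Qed.

Lemma tcons_tperm k (u : 'I_k.+1 -> T) i y :
  upd u i y \o tperm ord0 i = tcons y (fun p => u (tperm ord0 i (lift ord0 p))).
Proof.
apply/funext => p /=; case: (unliftP ord0 p) => [q ->|->].
  rewrite tconsS /upd; case: eqP => // E.
  have := congr1 (tperm ord0 i) E; rewrite tpermK tpermR => /eqP.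
  by rewrite eq_sym (negbTE (neq_lift _ _)).
by rewrite tpermL upd_same tcons0.
Qed.

End ConsTuple.

(** * Locality of the anchor and the bracket; tensoriality *)

Section Anchor.
Variables (R : realType) (n : nat) (M : manifold R n) (r : nat).
Variable A : lie_algebroid M r.
Implicit Types (X Y Z : section A) (f g : M -> R).
Local Notation S := (@smooth_section R n M r A).

Lemma lie_algebroid_bundle : is_vector_bundle A.
Proof. by have [] := lie_algebroidP A. Qed.
Let hA := lie_algebroid_bundle.

Lemma anchor_vector_linear x a (u v : A x) f : smooth f ->
  anchor (a *: u + v) f = a * anchor u f + anchor v f.
Proof. by have [_ [_ h _] _ _ _] := lie_algebroidP A; exact: h. Qed.

Lemma anchor_vector0 x f : smooth f -> anchor (0 : A x) f = 0.
Proof.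
move=> hf; have := anchor_vector_linear 1 (0 : A x) 0 hf.
by rewrite scaler0 addr0 mul1r => /addr_idem_eq0.
Qed.

Lemma anchor_vectorZ x a (u : A x) f : smooth f -> anchor (a *: u) f = a * anchor u f.
Proof.
by move=> hf; rewrite -[a *: u]addr0 anchor_vector_linear // anchor_vector0 // addr0.
Qed.

Lemma smooth_anchor X f : S X -> smooth f -> smooth (fun x => anchor (X x) f).
Proof. by have [_ [_ _ h] _ _ _] := lie_algebroidP A; exact: h. Qed.

Lemma anchor_linear x (v : A x) a f g : smooth f -> smooth g ->
  anchor v (fun y => a * f y + g y) = a * anchor v f + anchor v g.
Proof. by have [_ [h _ _] _ _ _] := lie_algebroidP A; have [hl _] := h x v; exact: hl. Qed.

Lemma anchorM x (v : A x) f g : smooth f -> smooth g ->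
  anchor v (fun y => f y * g y) = f x * anchor v g + anchor v f * g x.
Proof. by have [_ [h _ _] _ _ _] := lie_algebroidP A; have [_ hm] := h x v; exact: hm. Qed.

Lemma smooth_cst a : smooth (fun _ : M => a : R).
Proof. exact: smooth_on_cst. Qed.

Lemma anchor0 x (v : A x) : anchor v (fun=> 0) = 0.
Proof.
have := anchor_linear v 1 (smooth_cst 0) (smooth_cst 0).
rewrite (_ : (fun=> _) = (fun=> 0)); last by apply/funext => y; rewrite mul1r addr0.
by rewrite mul1r => /addr_idem_eq0.
Qed.

Lemma anchorD x (v : A x) f g : smooth f -> smooth g ->
  anchor v (fun y => f y + g y) = anchor v f + anchor v g.
Proof.
move=> hf hg; have := anchor_linear v 1 hf hg; rewrite mul1r => <-.
by congr anchor; apply/funext => y; rewrite mul1r.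
Qed.

Lemma anchorZ x (v : A x) a f : smooth f -> anchor v (fun y => a * f y) = a * anchor v f.
Proof.
move=> hf; have := anchor_linear v a hf (smooth_cst 0); rewrite anchor0 addr0 => <-.
by congr anchor; apply/funext => y; rewrite addr0.
Qed.

Lemma anchor_cst x (v : A x) a : anchor v (fun=> a) = 0.
Proof.
have := anchorM v (smooth_cst 1) (smooth_cst 1).
rewrite (_ : (fun=> _) = (fun=> 1)); last by apply/funext => y; rewrite mulr1.
rewrite mul1r mulr1 => /addr_idem_eq0 v1.
have := anchorZ v a (smooth_cst 1); rewrite v1 mulr0 => <-.
by congr anchor; apply/funext => y; rewrite mulr1.
Qed.

(** Let h = f - g. With b equal to 1 near x and supported in V, the product h b is 0 everywhere, and
    the product rule at x leaves v(h) = 0. *)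
Lemma anchor_local x (v : A x) f g (V : set M) : smooth f -> smooth g ->
  open V -> V x -> (forall y, V y -> f y = g y) -> anchor v f = anchor v g.
Proof.
move=> hf hg oV Vx fg.
have [b [K [hb cK KV bK b1]]] := bump_function oV Vx.
pose h y := -1 * g y + f y.
have hh : smooth h.
  apply: smooth_onD => //; first exact: openT.
  by apply: smooth_onM => //; [exact: openT|exact: smooth_cst].
have : anchor v (fun y => h y * b y) = 0.
  rewrite -[RHS](anchor0 v); congr anchor; apply/funext => y; rewrite /h.
  have [/KV /fg ->|/bK ->] := pselect (K y); last by rewrite mulr0.
  by rewrite mulN1r addNr mul0r.
rewrite anchorM // (nbhs_singleton b1) mulr1 {1}/h (fg x Vx) mulN1r addNr mul0r add0r.
by rewrite anchor_linear // mulN1r => /eqP; rewrite addrC subr_eq0 => /eqP.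
Qed.

Lemma smooth_bracket X Y : S X -> S Y -> S (bracket X Y).
Proof. by have [_ _ [h _ _] _ _] := lie_algebroidP A; exact: h. Qed.

Lemma bracket_linear_r a X Y Z x : S X -> S Y -> S Z ->
  bracket X (fun y => a *: Y y + Z y) x = a *: bracket X Y x + bracket X Z x.
Proof. by have [_ _ [_ _ h] _ _] := lie_algebroidP A => hX hY hZ; exact: h. Qed.

Lemma bracketC X Y x : S X -> S Y -> bracket X Y x = - bracket Y X x.
Proof. by have [_ _ _ [h _] _] := lie_algebroidP A => hX hY; exact: h. Qed.

Lemma bracket_jacobi X Y Z x : S X -> S Y -> S Z ->
  bracket X (bracket Y Z) x + bracket Y (bracket Z X) x + bracket Z (bracket X Y) x = 0.
Proof. by have [_ _ _ [_ h] _] := lie_algebroidP A => hX hY hZ; exact: h. Qed.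

Lemma bracketZr X Y f x : S X -> S Y -> smooth f ->
  bracket X (fun y => f y *: Y y) x = f x *: bracket X Y x + anchor (X x) f *: Y x.
Proof. by have [_ _ _ _ h] := lie_algebroidP A => hX hY hf; exact: h. Qed.

Lemma bracketDr X Y Z x : S X -> S Y -> S Z ->
  bracket X (fun y => Y y + Z y) x = bracket X Y x + bracket X Z x.
Proof.
move=> hX hY hZ; have := bracket_linear_r 1 x hX hY hZ; rewrite scale1r => <-.
by congr (bracket X _ x); apply: functional_extensionality_dep => y; rewrite scale1r.
Qed.

Lemma bracket_function_linear_r f X Y Z x : smooth f -> S X -> S Y -> S Z ->
  bracket X (fun y => f y *: Y y + Z y) x =
  f x *: bracket X Y x + anchor (X x) f *: Y x + bracket X Z x.
Proof.
move=> hf hX hY hZ; rewrite bracketDr ?bracketZr //.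
exact: smooth_sectionZ.
Qed.

Lemma bracket_function_linear_l f X Y Z x : smooth f -> S X -> S Y -> S Z ->
  bracket (fun y => f y *: Y y + Z y) X x =
  f x *: bracket Y X x - anchor (X x) f *: Y x + bracket Z X x.
Proof.
move=> hf hX hY hZ; rewrite bracketC //; last exact: smooth_section_linear.
rewrite bracket_function_linear_r // [bracket X Y x]bracketC // [bracket X Z x]bracketC //.
by rewrite !opprD scalerN !opprK.
Qed.

Lemma bracket_local X Y Z x (V : set M) : S X -> S Y -> S Z ->
  open V -> V x -> (forall y, V y -> Y y = Z y) -> bracket X Y x = bracket X Z x.
Proof.
move=> hX hY hZ oV Vx YZ.
have [b [K [hb cK KV bK b1]]] := bump_function oV Vx.
pose D y := (-1) *: Z y + Y y : A y.
have hD : S D by apply: smooth_section_linear => //; exact: smooth_cst.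
have h0 : S (fun y => 0 : A y) by exact: smooth_section0.
have b0 : bracket X (fun y => 0 : A y) x = 0.
  have := bracketZr x hX h0 (smooth_cst 0); rewrite scale0r scaler0 addr0 => <-.
  by congr (bracket X _ x); apply: functional_extensionality_dep => y; rewrite scaler0.
have : bracket X (fun y => b y *: D y) x = 0.
  rewrite -[RHS]b0; congr (bracket X _ x); apply: functional_extensionality_dep => y.
  have [/KV /YZ E|/bK ->] := pselect (K y); last by rewrite scale0r.
  by rewrite /D E scaleN1r addNr scaler0.
rewrite bracketZr // (nbhs_singleton b1) scale1r {2}/D (YZ x Vx) scaleN1r addNr scaler0 addr0.
by rewrite bracket_linear_r // scaleN1r => /eqP; rewrite addrC subr_eq0 => /eqP.
Qed.

(** A section D vanishing at x, with coordinates D^i in a local frame e'_i, is globally (1 - b^2) D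
    + sum_i (b D^i)(b e'_i). All these coefficients are smooth on M and vanish at x, so F D = 0
    without any restriction of F to local sections. *)
Lemma tensorial_pointwise (F : section A -> R) x Y Z :
  (forall f Y Z, smooth f -> S Y -> S Z -> F (fun y => f y *: Y y + Z y) = f x * F Y + F Z) ->
  S Y -> S Z -> Y x = Z x -> F Y = F Z.
Proof.
move=> hF hY hZ YZ.
have h0 : S (fun y => 0 : A y) by exact: smooth_section0.
have F0 : F (fun y => 0 : A y) = 0.
  have := hF (fun=> 1) _ _ (smooth_cst 1) h0 h0.
  rewrite (_ : (fun y => _) = (fun y => 0 : A y)); last first.
    by apply: functional_extensionality_dep => y; rewrite scaler0 addr0.
  by rewrite mul1r => /addr_idem_eq0.
pose D y := (-1) *: Z y + Y y : A y.
have hD : S D by apply: smooth_section_linear => //; exact: smooth_cst.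
have Dx : D x = 0 by rewrite /D YZ scaleN1r addNr.
suff : F D = 0.
  by rewrite /D hF //; [rewrite mulN1r => /eqP; rewrite addrC subr_eq0 => /eqP|exact: smooth_cst].
have [t [b [e [tE tx he eE [hb [K [cK KW bK]] [V [_ Vx _ b1]]]]]]] := local_frame hA x.
pose g i y := b y * triv_map t y (D y) 0 i.
have hg i : smooth (g i).
  have oW := triv_open hA tE.
  apply: smooth_on_local => y _; have [ty|nty] := pselect (triv_dom t y).
    exists (triv_dom t), (g i); split => //; apply: smooth_onM => //.
      exact: smooth_onS hb.
    exact: hD.
  exists (~` K), (fun=> 0); split => //.
  - exact: closed_openC.
  - by move=> /KW.
  - exact: smooth_on_cst.
  - by move=> z /bK bz; rewrite /g bz mul0r.
have hb2 : smooth (fun y => 1 - b y * b y).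
  apply: smooth_onB; [exact: openT|exact: smooth_cst|].
  by apply: smooth_onM => //; exact: openT.
pose rest (l : seq 'I_r) y := \sum_(i <- l) g i y *: e i y : A y.
have hrest l : S (rest l).
  by apply: smooth_section_sum => // i; exact: smooth_sectionZ.
have Frest l : F (rest l) = 0.
  elim: l => [|i l IH].
    rewrite -[RHS]F0; congr F; apply: functional_extensionality_dep => y.
    by rewrite /rest big_nil.
  have -> : rest (i :: l) = (fun y => g i y *: e i y + rest l y).
    by apply: functional_extensionality_dep => y; rewrite /rest big_cons.
  by rewrite hF // IH /g Dx linear0 mxE mulr0 mul0r addr0.
have -> : D = (fun y => (1 - b y * b y) *: D y + rest (index_enum _) y).
  apply: functional_extensionality_dep => y; rewrite scalerBl scale1r /rest.
  apply/esym; rewrite -[RHS]addr0 -addrA; congr (_ + _).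
  apply/eqP; rewrite addrC subr_eq0; apply/eqP.
  under eq_bigr => i _ do rewrite eE scalerA /g mulrAC -scalerA.
  have [/KW ty|/bK ->] := pselect (K y); last first.
    rewrite mul0r scale0r big1 // => i _; by rewrite scale0r.
  rewrite -scaler_sumr; congr (_ *: _).
  by rewrite [RHS](basis_sum (fun i => triv_map_frame hA i tE ty) (triv_map_inj hA tE ty)).
by rewrite hF // b1 // mulr1 subrr mul0r add0r.
Qed.

End Anchor.

(** * The Koszul formula *)

Section Koszul.
Variables (R : realType) (n : nat) (M : manifold R n) (r : nat).
Variable A : lie_algebroid M r.
Implicit Types (X Y Z : section A) (f g : M -> R).
Local Notation S := (@smooth_section R n M r A).
Local Notation SF k := (@smooth_section R n M _ (forms k A)).
Let hA : is_vector_bundle A := lie_algebroid_bundle A.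

Definition eval_form k (w : section (forms k A)) (U : 'I_k -> section A) (x : M) : R :=
  w x (fun i => U i x).

Lemma smooth_eval_form k (w : section (forms k A)) U : SF k w ->
  (forall i, S (U i)) -> smooth (eval_form w U).
Proof. by move=> hw hU; exact: smooth_form_eval. Qed.

Lemma eval_tcons k X (U : 'I_k -> section A) x :
  (fun i => tcons X U i x) = cons_arg (X x) (fun i => U i x).
Proof.
apply/funext => p; case: (unliftP ord0 p) => [q ->|->].
  by rewrite tconsS cons_argS.
by rewrite tcons0 cons_arg0.
Qed.

Definition contract_form k X (w : section (forms k.+1 A)) : section (forms k A) :=
  fun y => contract (X y) (w y).

Lemma eval_contract k X (w : section (forms k.+1 A)) U x :
  eval_form (contract_form X w) U x = eval_form w (tcons X U) x.
Proof. by rewrite /eval_form eval_tcons. Qed.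

Lemma smooth_tcons k X (U : 'I_k -> section A) : S X -> (forall i, S (U i)) ->
  forall i, S (tcons X U i).
Proof.
move=> hX hU i; case: (unliftP ord0 i) => [j ->|->]; by rewrite ?tconsS ?tcons0.
Qed.

Lemma smooth_upd k X (U : 'I_k -> section A) j : S X -> (forall i, S (U i)) ->
  forall i, S (upd U j X i).
Proof. by move=> hX hU i; rewrite /upd; case: eqP. Qed.

Lemma smooth_contract_form k X (w : section (forms k.+1 A)) : S X -> SF k.+1 w ->
  SF k (contract_form X w).
Proof.
move=> hX hw; apply: smooth_form_of_eval => // U hU.
have := smooth_eval_form hw (smooth_tcons hX hU); congr smooth.
by apply/funext => x; rewrite -eval_contract.
Qed.

(* (L_X w)(U), by the formula that does not involve d_A. *)
Definition lie_eval k (w : section (forms k A)) X (U : 'I_k -> section A) (x : M) : R :=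
  anchor (X x) (eval_form w U) -
  \sum_(j < k) w x (upd (fun i => U i x) j (bracket X (U j) x)).

Lemma koszul0 (w : section (forms 0 A)) X U x :
  koszul w (tcons X U) x = lie_eval w X U x.
Proof.
rewrite /koszul /lie_eval big_ord0 subr0 big_ord_recl big_ord0 addr0 mul1r.
rewrite big_ord_recl big_ord0 addr0 [X in _ + X]big_ord0 addr0 tcons0.
congr anchor; apply/funext => y; congr (w y _); apply/funext => -[] //.
Qed.

(** A rearrangement of sums, valid for arbitrary sections. The terms that differentiate along X or
    bracket with X make up L_X w; in the others X is a mere argument, and shifting the indices by
    one changes their sign. *)
Lemma koszul_cartan k (w : section (forms k.+1 A)) X U x :
  koszul w (tcons X U) x = lie_eval w X U x - koszul (contract_form X w) U x.
Proof.
rewrite /koszul /lie_eval.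
rewrite big_ord_recl /= mul1r tcons0.
have -> : (fun y => w y (fun p => tcons X U (lift ord0 p) y)) = eval_form w U.
  apply/funext => y; congr (w y _); apply/funext => p; by rewrite tconsS.
rewrite -!addrA; congr (_ + _).
have -> : \sum_(i < k.+1) (-1) ^+ bump 0 i *
    anchor (tcons X U (lift ord0 i) x)
      (fun y => w y (fun p => tcons X U (lift (lift ord0 i) p) y)) =
    - \sum_(i < k.+1) (-1) ^+ i * anchor (U i x)
      (fun y => contract_form X w y (fun p => U (lift i p) y)).
  rewrite -sumrN; apply: eq_bigr => i _.
  rewrite tconsS /bump add1n exprS mulN1r mulNr; congr (- (_ * anchor _ _)).
  apply/funext => y; rewrite /= /contract_fun; congr (w y _).
  by rewrite -(eval_tcons X (fun p => U (lift i p))) -(tcons_lift X U i).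
rewrite opprD [RHS]addrCA; congr (_ + _).
rewrite big_ord_recl big_pred0 // add0r -!sumrN -big_split /=.
apply: eq_bigr => j _.
(* Inner index 0 gives the brackets [X, U_j] of L_X w; the larger ones give the brackets in d (i_X
   w). *)
rewrite big_mkcond big_ord_recl /= -big_mkcond /=.
congr (_ + _).
  rewrite [lift (lift _ _) _]lift_lift00 tcons0 tconsS.
  have -> : [eta fun p => tcons X U (lift (lift ord0 j) p) x with ord0 |-> bracket X (U j) x]
    = cons_arg (bracket X (U j) x) (fun p : 'I_k => U (lift j p) x) :> ('I_k.+1 -> A x).
    apply/funext => p /=; case: (unliftP ord0 p) => [q ->|->].
      by rewrite cons_argS lift_lift0 tconsS.
    by rewrite cons_arg0.
  rewrite (alt_move_front (w x) (fun p => U p x)).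
  by rewrite /bump add1n exprS mulN1r mulNr mulrA -expr2 sqrr_sign mul1r.
rewrite -sumrN; apply: eq_big => // i ij.
rewrite /bump add1n exprS mulN1r mulNr; congr (- (_ * _)).
rewrite lift_lift0 !tconsS /= /contract_fun; congr (w x _).
apply/funext => p /=; case: (unliftP ord0 p) => [q ->|->].
  rewrite cons_argS (inj_eq (@lift_inj _ _)) lift_lift0 tconsS; by [].
by rewrite (negbTE (neq_lift _ _)) cons_arg0 lift_lift00 tcons0.
Qed.

(** The additional sum is (df /\ w)(U). *)
Lemma koszul_function_linear k f (w z : section (forms k A)) U x :
  smooth f -> SF k w -> SF k z -> (forall i, S (U i)) ->
  koszul (fun y => f y *: w y + z y : forms k A y) U x =
  f x * koszul w U x + koszul z U x +
  \sum_(i < k.+1) (-1) ^+ i * (anchor (U i x) f * w x (fun p => U (lift i p) x)).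
Proof.
move=> hf hw hz hU; rewrite /koszul.
have -> : \sum_(i < k.+1) (-1) ^+ i * anchor (U i x)
    (fun y => (f y *: w y + z y) (fun p => U (lift i p) y)) =
  f x * (\sum_(i < k.+1) (-1) ^+ i * anchor (U i x) (fun y => w y (fun p => U (lift i p) y)))
  + \sum_(i < k.+1) (-1) ^+ i * anchor (U i x) (fun y => z y (fun p => U (lift i p) y))
  + \sum_(i < k.+1) (-1) ^+ i * (anchor (U i x) f * w x (fun p => U (lift i p) x)).
  rewrite mulr_sumr -!big_split /=; apply: eq_bigr => i _.
  have hw' := smooth_eval_form hw (fun p => hU (lift i p)).
  have hz' := smooth_eval_form hz (fun p => hU (lift i p)).
  have hfw : smooth (fun y => f y * eval_form w (fun p => U (lift i p)) y).
    by apply: smooth_onM => //; exact: openT.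
  have := anchorD (U i x) hfw hz'.
  rewrite (anchorM (U i x) hf hw') => E.
  rewrite [anchor _ _]E /eval_form; ring.
have -> : \sum_(j < k.+1) \sum_(i < k | (i < j)%N) (-1) ^+ j *
   (f x *: w x + z x) [eta fun p => U (lift j p) x with i |-> bracket (U (lift j i)) (U j) x]
  = f x * (\sum_(j < k.+1) \sum_(i < k | (i < j)%N) (-1) ^+ j *
     w x [eta fun p => U (lift j p) x with i |-> bracket (U (lift j i)) (U j) x]) +
   \sum_(j < k.+1) \sum_(i < k | (i < j)%N) (-1) ^+ j *
     z x [eta fun p => U (lift j p) x with i |-> bracket (U (lift j i)) (U j) x].
  rewrite mulr_sumr -big_split /=; apply: eq_bigr => j _.
  rewrite mulr_sumr -big_split /=; apply: eq_bigr => i _.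
  by rewrite [X in _ = X + _]mulrCA -mulrDr.
by ring.
Qed.

Lemma koszulN k (w : section (forms k A)) U x : SF k w -> (forall i, S (U i)) ->
  koszul (fun y => - w y : forms k A y) U x = - koszul w U x.
Proof.
move=> hw hU.
have h1 : smooth (fun _ : M => -1 : R) by exact: smooth_cst.
have h0 : SF k (fun y => 0 : forms k A y).
  by apply: smooth_section0; exact: forms_vector_bundle.
have Z0 : koszul (fun y => 0 : forms k A y) U x = 0.
  rewrite /koszul !big1 ?addr0 // => i _.
    by rewrite big1 // => j _; exact: mulr0.
  by apply/eqP; rewrite mulf_eq0; apply/orP; right; apply/eqP; exact: anchor0.
have := koszul_function_linear x h1 hw h0 hU.
rewrite Z0 addr0 mulN1r big1 ?addr0 => [<-|i _].
  congr (koszul _ U x); apply: functional_extensionality_dep => y.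
  by rewrite addr0 scaleN1r.
by rewrite anchor_cst mul0r mulr0.
Qed.

End Koszul.

(** * Tensoriality and antisymmetry of the Koszul formula; existence of [d_A] *)

Section KoszulTensor.
Variables (R : realType) (n : nat) (M : manifold R n) (r : nat).
Variable A : lie_algebroid M r.
Implicit Types (X Y Z : section A) (f g : M -> R).
Local Notation S := (@smooth_section R n M r A).
Local Notation SF k := (@smooth_section R n M _ (forms k A)).
Let hA : is_vector_bundle A := lie_algebroid_bundle A.

(** The additional sum is (df /\ i_Y w)(U). *)
Lemma lie_eval_function_linear k f (w : section (forms k A)) Y Z U x :
  smooth f -> SF k w -> S Y -> S Z -> (forall i, S (U i)) ->
  lie_eval w (fun y => f y *: Y y + Z y) U x =
  f x * lie_eval w Y U x + lie_eval w Z U x +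
  \sum_(j < k) anchor (U j x) f * w x (upd (fun i => U i x) j (Y x)).
Proof.
move=> hf hw hY hZ hU; rewrite /lie_eval anchor_vector_linear; last exact: smooth_eval_form.
under eq_bigr => j _.
  rewrite bracket_function_linear_l // alt_add -scaleNr alt_linear alt_scale mulNr.
  over.
rewrite /= !big_split /= sumrN mulrBr mulr_sumr.
ring.
Qed.

(** In Cartan's formula the term df /\ i_Y w appears in both L_(fY) w and d (f i_Y w), and
    cancels. *)
Lemma koszul_function_linear0 k f (w : section (forms k A)) Y Z U x :
  smooth f -> SF k w -> S Y -> S Z -> (forall i, S (U i)) ->
  koszul w (tcons (fun y => f y *: Y y + Z y) U) x =
  f x * koszul w (tcons Y U) x + koszul w (tcons Z U) x.
Proof.
case: k w U => [|k] w U hf hw hY hZ hU.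
  by rewrite !koszul0 lie_eval_function_linear // big_ord0 addr0.
rewrite !koszul_cartan lie_eval_function_linear //.
have -> : contract_form (fun y => f y *: Y y + Z y) w =
    (fun y => f y *: contract_form Y w y + contract_form Z w y).
  by apply: functional_extensionality_dep => y; exact: contract_linear.
rewrite koszul_function_linear //; try exact: smooth_contract_form.
have -> : \sum_(i < k.+1) (-1) ^+ i * (anchor (U i x) f *
     contract_form Y w x (fun p => U (lift i p) x)) =
    \sum_(j < k.+1) anchor (U j x) f * w x (upd (fun i => U i x) j (Y x)).
  apply: eq_bigr => i _; rewrite /= /contract_fun.
  rewrite (alt_move_front (w x) (fun p => U p x)) mulrCA; congr (_ * _).
  by rewrite mulrA -expr2 sqrr_sign mul1r.
ring.
Qed.

Lemma lie_eval_perm k (w : section (forms k A)) X U (s : 'S_k) x :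
  SF k w -> (forall i, S (U i)) ->
  lie_eval w X (U \o s) x = (-1) ^+ s * lie_eval w X U x.
Proof.
move=> hw hU; rewrite /lie_eval mulrBr; congr (_ - _).
  rewrite -anchorZ; last exact: smooth_eval_form.
  congr anchor; apply/funext => y; exact: (alt_perm (w y) (fun i => U i y)).
rewrite mulr_sumr [RHS](reindex_inj (@perm_inj _ s)) /=; apply: eq_bigr => j _.
by rewrite -alt_perm -upd_comp.
Qed.

Lemma lie_eval_tcons k (w : section (forms k.+1 A)) X Y U x :
  lie_eval w X (tcons Y U) x =
  anchor (X x) (eval_form w (tcons Y U)) - w x (cons_arg (bracket X Y x) (fun i => U i x)) -
  \sum_(j < k) contract_form Y w x (upd (fun i => U i x) j (bracket X (U j) x)).
Proof.
rewrite /lie_eval big_ord_recl -!addrA -opprD tcons0; congr (_ - (w x _ + _)).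
  by rewrite eval_tcons; apply/funext => p; rewrite /upd; case: (unliftP ord0 p) => [q ->|->];
    rewrite ?cons_argS ?cons_arg0 // eq_sym (negbTE (neq_lift _ _)).
apply: eq_bigr => j _; rewrite tconsS eval_tcons /= /contract_fun; congr (w x _).
apply/funext => p; rewrite /upd; case: (unliftP ord0 p) => [q ->|->].
  by rewrite !cons_argS (inj_eq (@lift_inj _ _)).
by rewrite !cons_arg0 (negbTE (neq_lift _ _)).
Qed.

Lemma contract_formC k (w : section (forms k.+2 A)) X Y :
  contract_form Y (contract_form X w) =
  (fun y => - contract_form X (contract_form Y w) y).
Proof.
apply: functional_extensionality_dep => y; apply: altform_eq => u.
have -> : (- contract_form X (contract_form Y w) y) u =
  - (contract_form X (contract_form Y w) y u) by [].
rewrite /= /contract_fun /= /contract_fun.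
have cE x v : cons_arg x v = tcons x v by [].
rewrite !cE -(tcons_swap (Y y)) alt_tperm //.
Qed.

(** Cartan's formula applied twice leaves d (i_Y i_X w), skew in X and Y since contractions
    anticommute, and terms of the two Lie derivatives that visibly change sign together. *)
Lemma koszul_swap k (w : section (forms k.+1 A)) X Y U x :
  SF k.+1 w -> S X -> S Y -> (forall i, S (U i)) ->
  koszul w (tcons X (tcons Y U)) x = - koszul w (tcons Y (tcons X U)) x.
Proof.
move=> hw hX hY hU.
(* [tl] is the term with two contractions; for w of degree 1 there is no second contraction and it
   is 0. *)
have [tl [tE tC]] : exists tl : section A -> section A -> R,
    (forall X Y, S X -> S Y -> koszul (contract_form X w) (tcons Y U) x =
       lie_eval (contract_form X w) Y U x - tl X Y) /\
    (forall X Y, S X -> S Y -> tl X Y = - tl Y X).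
  case: k w U hw hU => [|k] w U hw hU.
    exists (fun _ _ => 0); split => X' Y' _ _; rewrite ?oppr0 //.
    by rewrite koszul0 addr0.
  exists (fun X' Y' => koszul (contract_form Y' (contract_form X' w)) U x).
  split => X' Y' hX' hY'; first by rewrite koszul_cartan.
  rewrite contract_formC koszulN //.
  by apply: smooth_contract_form => //; exact: smooth_contract_form.
rewrite !koszul_cartan !tE // !lie_eval_tcons (tC Y X) //.
rewrite /lie_eval (bracketC x hY hX).
have cN v : w x (cons_arg (- v) (fun i => U i x)) = - w x (cons_arg v (fun i => U i x)).
  have E t : cons_arg t (fun i => U i x) = upd (cons_arg 0 (fun i => U i x)) ord0 t.
    exact/esym/tcons_upd0.
  by rewrite (E (- v)) (E v) -scaleN1r alt_scale mulN1r.
rewrite cN.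
have eE X' V : eval_form (contract_form X' w) V = eval_form w (tcons X' V).
  by apply/funext => y; rewrite eval_contract.
rewrite !eE; ring.
Qed.

(** Permutations fixing the first place are covered by Cartan's formula and the induction
    hypothesis. Together with the swap of the first two places they generate the symmetric group. *)
Lemma koszul_perm k (w : section (forms k A)) U (s : 'S_k.+1) x :
  SF k w -> (forall i, S (U i)) ->
  koszul w (U \o s) x = (-1) ^+ s * koszul w U x.
Proof.
elim: k w U s => [|k IH] w U s hw.
  have -> : s = 1%g by apply/permP => i; rewrite !ord1.
  rewrite odd_perm1 mul1r => _; congr (koszul _ _ _).
  by apply/funext => i; rewrite /= perm1.
pose Q (s : 'S_k.+2) := forall U, (forall i, S (U i)) ->
  koszul w (U \o s) x = (-1) ^+ s * koszul w U x.
have Q1 : Q 1%g.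
  move=> V hV; rewrite odd_perm1 mul1r; congr (koszul _ _ _).
  by apply/funext => i; rewrite /= perm1.
have QM s1 s2 : Q s1 -> Q s2 -> Q (s1 * s2)%g.
  move=> h1 h2 V hV; have -> : V \o (s1 * s2)%g = (V \o s2) \o s1.
    by apply/funext => i; rewrite /= permM.
  by rewrite h1 => [|i]; [rewrite h2 // mulrA -signr_addb -odd_permM|exact: hV].
have Qlift s1 : Q (lift_perm ord0 ord0 s1).
  move=> V hV; rewrite (tcons_eta V) tcons_perm !koszul_cartan lie_eval_perm //.
  rewrite IH //; last exact: smooth_contract_form.
  have -> : lift_perm ord0 ord0 s1 = s1 :> bool by rewrite odd_lift_perm.
  by rewrite [RHS]mulrBr.
have Qswap : Q (tperm ord0 (lift ord0 ord0)).
  move=> V hV; rewrite (tcons_eta V) (tcons_eta (fun i => V (lift ord0 i))).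
  by rewrite tcons_swap odd_tperm mulN1r; apply: koszul_swap.
have lift_tperm i j : lift_perm ord0 ord0 (tperm i j) = tperm (lift ord0 i) (lift ord0 j) :> 'S_k.+2.
  apply/permP => p; case: (unliftP ord0 p) => [q ->|->].
    rewrite lift_perm_lift; case: (tpermP i j q) => [->|->|/eqP iq /eqP jq].
    - by rewrite tpermL.
    - by rewrite tpermR.
    - by rewrite tpermD // (inj_eq (@lift_inj _ _)) eq_sym.
  by rewrite lift_perm_id tpermD // eq_sym neq_lift.
have Q0 j : Q (tperm ord0 (lift ord0 j)).
  (* Any transposition moving the first place is a conjugate of the swap by a permutation that fixes
     it. *)
  have -> : tperm ord0 (lift ord0 j) =
    (tperm ord0 (lift ord0 ord0) ^ lift_perm ord0 ord0 (tperm ord0 j))%g.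
    by rewrite tpermJ lift_perm_id lift_perm_lift tpermL.
  have QV : Q (lift_perm ord0 ord0 (tperm ord0 j))^-1%g.
    by rewrite lift_tperm tpermV -lift_tperm.
  by rewrite conjgE; exact: (QM _ _ QV (QM _ _ Qswap (Qlift _))).
have Qt i j : Q (tperm i j).
  case: (unliftP ord0 i) => [i' ->|->]; case: (unliftP ord0 j) => [j' ->|->].
  - by rewrite -lift_tperm.
  - by rewrite tpermC.
  - exact: Q0.
  - by rewrite tperm1.
move=> hU; suff : Q s by apply.
have [ts -> _] := prod_tpermP s; elim: ts => [|t ts IHt]; first by rewrite big_nil.
by rewrite big_cons; apply: QM.
Qed.

Lemma koszul_alternating k (w : section (forms k A)) U i j x :
  SF k w -> (forall i, S (U i)) -> i != j -> U i = U j -> koszul w U x = 0.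
Proof.
move=> hw hU ij Uij; have := koszul_perm (tperm i j) x hw hU.
have -> : U \o tperm i j = U.
  by apply/funext => p /=; case: tpermP => // ->.
rewrite odd_tperm ij mulN1r => /eqP.
by rewrite -addr_eq0 -mulr2n mulrn_eq0 /= => /eqP.
Qed.

Lemma koszul_upd_linear k f (w : section (forms k A)) Y Z U i x :
  smooth f -> SF k w -> S Y -> S Z -> (forall i, S (U i)) ->
  koszul w (upd U i (fun y => f y *: Y y + Z y)) x =
  f x * koszul w (upd U i Y) x + koszul w (upd U i Z) x.
Proof.
move=> hf hw hY hZ hU.
pose T p := U (tperm ord0 i (lift ord0 p)).
have E V : S V -> koszul w (upd U i V) x =
    (-1) ^+ tperm ord0 i * koszul w (tcons V T) x.
  move=> hV; rewrite -tcons_tperm koszul_perm //; last exact: smooth_upd.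
  by rewrite mulrA -expr2 sqrr_sign mul1r.
rewrite !E //; last exact: smooth_section_linear.
rewrite koszul_function_linear0 //; last by move=> p; exact: hU.
by rewrite mulrDr mulrCA.
Qed.

Lemma koszul_pointwise k (w : section (forms k A)) U V x :
  SF k w -> (forall i, S (U i)) -> (forall i, S (V i)) ->
  (forall i, U i x = V i x) -> koszul w U x = koszul w V x.
Proof.
move=> hw hU hV UV.
have step W i Y : (forall j, S (W j)) -> S Y -> W i x = Y x ->
    koszul w W x = koszul w (upd W i Y) x.
  move=> hW hY WY; rewrite -{1}(upd_id W i).
  apply: (tensorial_pointwise (F := fun Y => koszul w (upd W i Y) x)) WY => //.
  by move=> f Y' Z' hf hY' hZ'; exact: koszul_upd_linear.
(* Tensoriality concerns one argument at a time, so U is turned into V place by place. *)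
pose H m (p : 'I_k.+1) := if (p < m)%N then V p else U p.
have HE m : koszul w U x = koszul w (H m) x.
  elim: m => [|m ->]; first by [].
  have hH j : S (H m j) by rewrite /H; case: ifP.
  have [mk|km] := ltnP m k.+1; last first.
    congr (koszul w _ x); apply/funext => p; rewrite /H.
    by rewrite (leq_trans (ltn_ord p) km) (leq_trans (ltn_ord p) (leqW km)).
  rewrite (step _ (Ordinal mk) (V (Ordinal mk))) //; last by rewrite /H ltnn.
  congr (koszul w _ x); apply/funext => p; rewrite /H /upd ltnS [in RHS]leq_eqVlt -val_eqE /=.
  by case: eqP => [E|//] /=; rewrite (_ : p = Ordinal mk) //; apply: val_inj.
rewrite (HE k.+1); congr (koszul w _ x); apply/funext => p.
by rewrite /H ltn_ord.
Qed.

(** Applying the Koszul formula to linear extensions of vectors defines an alternating form on the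
    fibre. By [koszul_pointwise] it meets the condition in [d_A], so [xget] does not return its
    default value. *)
Lemma d_AE k (w : section (forms k A)) U x : SF k w -> (forall i, S (U i)) ->
  d_A w x (fun i => U i x) = koszul w U x.
Proof.
move=> hw hU.
have [ext [hext extx extl]] := section_extension hA x.
pose z (v : 'I_k.+1 -> A x) := koszul w (fun i => ext (v i)) x.
have zP : z \in @is_altform R (A x) k.+1.
  apply/asboolP; split => [v i a u u'|v i j ij vij].
    have E (t : A x) : z [eta v with i |-> t] = koszul w (upd (fun i => ext (v i)) i (ext t)) x.
      by congr (koszul w _ x); apply/funext => p; rewrite /upd /=; case: eqP.
    rewrite !E -koszul_upd_linear //; last exact: smooth_cst.
    congr (koszul w (upd _ _ _) x); apply: functional_extensionality_dep => y.
    exact: extl.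
  by apply: koszul_alternating ij _ => //; rewrite vij.
rewrite /d_A; case: xgetP => [y _ yP|/(_ (AltForm zP))]; first exact: yP.
case=> V hV /=; apply: koszul_pointwise => // i; rewrite extx.
Qed.

Lemma lie_derivativeE k (w : section (forms k A)) X U x :
  SF k w -> S X -> (forall i, S (U i)) ->
  lie_derivative X w x (fun i => U i x) = lie_eval w X U x.
Proof.
case: k w U => [|k] w U hw hX hU.
  rewrite /= /contract_fun -eval_tcons d_AE ?koszul0 //; exact: smooth_tcons.
have -> : lie_derivative X w x (fun i => U i x) =
  contract (X x) (d_A w x) (fun i => U i x) +
  d_A (contract_form X w) x (fun i => U i x) by [].
rewrite d_AE //; last exact: smooth_contract_form.
rewrite /= /contract_fun -eval_tcons d_AE //; last exact: smooth_tcons.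
by rewrite koszul_cartan subrK.
Qed.

End KoszulTensor.

(** * The Nambu bracket *)

Section AnchorMorphism.
Variables (R : realType) (n : nat) (M : manifold R n) (r : nat).
Variable A : lie_algebroid M r.
Implicit Types (X Y Z : section A) (f g : M -> R).
Local Notation S := (@smooth_section R n M r A).
Let hA : is_vector_bundle A := lie_algebroid_bundle A.

Lemma bracketNr X Y x : S X -> S Y -> bracket X (fun y => - Y y : A y) x = - bracket X Y x.
Proof.
move=> hX hY; have := bracketZr x hX hY (smooth_cst (-1)).
rewrite anchor_cst scale0r addr0 scaleN1r => <-.
by congr (bracket X _ x); apply: functional_extensionality_dep => y; rewrite scaleN1r.
Qed.

Lemma bracket_leibniz X Y Z x : S X -> S Y -> S Z ->
  bracket X (bracket Y Z) x = bracket (bracket X Y) Z x + bracket Y (bracket X Z) x.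
Proof.
move=> hX hY hZ; have := bracket_jacobi x hX hY hZ.
have -> : bracket Z X = (fun y => - bracket X Z y : A y).
  by apply: functional_extensionality_dep => y; exact: bracketC.
rewrite bracketNr //; last exact: smooth_bracket.
rewrite [bracket Z _ x]bracketC //; last exact: smooth_bracket.
move=> /eqP; rewrite subr_eq0 => /eqP E.
by apply/eqP; rewrite -subr_eq -E.
Qed.

(** Expand the Jacobi identity for X, Y and g Z by the Leibniz rule. Everything cancels except a
    multiple of Z, whose coefficient is the difference of the two sides. A positive rank provides a
    Z with Z x non-zero, and the coordinate [phi] reads the coefficient. *)
Lemma anchor_bracket X Y g x : (0 < r)%N -> S X -> S Y -> smooth g ->
  anchor (bracket X Y x) g =
  anchor (X x) (fun y => anchor (Y y) g) - anchor (Y x) (fun y => anchor (X y) g).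
Proof.
move=> r0 hX hY hg.
have [_ cov _] := hA; have [t tE tx] := cov x.
have [ext [hext extx _]] := section_extension hA x.
pose i0 := Ordinal r0; pose Z := ext (frame t x i0); have hZ : S Z by exact: hext.
pose phi (v : A x) := triv_map t x v 0 i0.
have phiD u v : phi (u + v) = phi u + phi v by rewrite /phi linearD mxE.
have phiZ a v : phi (a *: v) = a * phi v by rewrite /phi linearZ mxE.
have phi1 : phi (Z x) = 1 by rewrite /phi /Z extx triv_map_frame // mxE !eqxx.
have hXg := smooth_anchor hX hg; have hYg := smooth_anchor hY hg.
have hgZ : S (fun y => g y *: Z y) by exact: smooth_sectionZ.
have E W : S W -> bracket W (fun y => g y *: Z y) =
    (fun y => g y *: bracket W Z y + anchor (W y) g *: Z y).
  by move=> hW; apply: functional_extensionality_dep => y; exact: bracketZr.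
have E2 W T : S W -> S T -> bracket W (bracket T (fun y => g y *: Z y)) x =
    g x *: bracket W (bracket T Z) x + anchor (W x) g *: bracket T Z x +
    (anchor (T x) g *: bracket W Z x + anchor (W x) (fun y => anchor (T y) g) *: Z x).
  move=> hW hT; have hTg := smooth_anchor hT hg; have hTZ := smooth_bracket hT hZ.
  rewrite E // bracketDr ?bracketZr //; exact: smooth_sectionZ.
have := bracket_leibniz x hX hY hgZ.
rewrite !E2 // bracketZr //; last exact: smooth_bracket.
rewrite (bracket_leibniz x hX hY hZ) => /(congr1 phi).
rewrite !(phiD, phiZ) phi1 => H.
move: (phi _) (phi _) (phi _) (phi _) H => p q s u H; lra.
Qed.

End AnchorMorphism.

Section Nambu.
Variables (R : realType) (n : nat) (M : manifold R n) (m : nat).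
Variable A : lie_algebroid M m.+1.
Variable Pi : section (multivectors m.+1 A).
Hypothesis Pi_smooth : smooth_section Pi.
Implicit Types (X Y Z : section A) (mu : section (forms m.+1 A)).
Implicit Types (a b : section (forms m A)).
Local Notation S := (@smooth_section R n M _ A).
Local Notation SF k := (@smooth_section R n M _ (forms k A)).
Let hA : is_vector_bundle A := lie_algebroid_bundle A.

Definition density mu x : R := pairing (Pi x) (mu x).

Lemma smooth_density mu : SF m.+1 mu -> smooth (density mu).
Proof.
move=> hmu; have hF := forms_vector_bundle hA m.+1.
exact: (smooth_form_eval hF Pi_smooth (fun _ : 'I_1 => hmu)).
Qed.

Lemma sharp_contract_form X mu x :
  sharp (Pi x) (contract_form X mu x) = ((-1) ^+ m * density mu x) *: X x.
Proof.
have [_ cov _] := hA; have [t tE tx] := cov x.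
exact: (sharp_contract (fun i => triv_map_frame hA i tE tx) (triv_map_inj hA tE tx)).
Qed.

(** [sharp] is defined by a choice, so linearity is not immediate; it follows from the formula of
    [sharp_contract], since every form of degree m is a contraction of the determinant form. *)
Lemma sharp_linear x k (u v : altform (A x) m) :
  sharp (Pi x) (k *: u + v) = k *: sharp (Pi x) u + sharp (Pi x) v.
Proof.
have [_ cov _] := hA; have [t tE tx] := cov x.
have ce i := triv_map_frame hA i tE tx; have ci := triv_map_inj hA tE tx.
pose e := frame t x.
have sharpE w := sharp_contract ce ci (Pi x) (basis_form (triv_map t x) id)
  (\sum_(i < m.+1) ((-1) ^+ i * w (fun p => e (lift i p))) *: e i).
have repE (w : altform (A x) m) := contract_top_form ce ci w (det_form_basis ce).
rewrite -{1}(repE (k *: u + v)) -{2}(repE u) -{2}(repE v) !sharpE.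
rewrite [k *: (_ *: _)]scalerA [k * _]mulrC -[(_ * k) *: _]scalerA -scalerDr; congr (_ *: _).
rewrite scaler_sumr -big_split; apply: eq_bigr => i _ /=.
rewrite scalerA -scalerDl; congr (_ *: _).
transitivity ((-1) ^+ i * (k * u (fun p => e (lift i p)) + v (fun p => e (lift i p)))).
  by [].
ring.
Qed.

(** mu is the determinant form of a local frame times a bump function, and [rep] is the inverse of
    [contract_top_form] written in the cut-off frame. Both are smooth on M, but they invert each
    other only on V, where the bump function is 1. *)
Lemma local_contraction x0 : exists mu (rep : section (forms m A) -> section A) (V : set M),
  [/\ SF m.+1 mu, forall a, SF m a -> S (rep a), open V, V x0 &
      (forall a y, V y -> contract_form (rep a) mu y = a y) /\
      (forall k a b y, rep (fun z => k *: a z + b z) y = k *: rep a y + rep b y)].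
Proof.
have [t [b [e [tE tx he eE [hb [K [cK KW bK]] [V [oV Vx VW b1]]]]]]] := local_frame hA x0.
exists (fun y => b y *: basis_form (triv_map t y) id).
exists (fun a y => \sum_(i < m.+1) ((-1) ^+ i * eval_form a (fun p => e (lift i p)) y) *: e i y).
exists V; split => //.
- apply: smooth_form_of_eval => // U hU.
  apply: smooth_on_local => x _; have [Wx|nWx] := pselect (triv_dom t x).
    exists (triv_dom t), (fun y => b y * \det (\matrix_(p, q) triv_map t y (U q y) 0 p)).
    have oW := triv_open hA tE; split => //.
    apply: smooth_onM => //; first by apply: smooth_onS hb.
    by apply: smooth_on_det => // p q; exact: hU.
  exists (~` K), (fun=> 0); split => //.
  + exact: closed_openC.
  + by move=> /KW.
  + exact: smooth_on_cst.
  + by move=> y /bK ->; rewrite scale0r.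
- move=> a ha; apply: smooth_section_sum => // i.
  apply: smooth_sectionZ => //; apply: smooth_onM; first exact: openT.
    exact: smooth_cst.
  exact: smooth_eval_form.
- split => [a y Vy|k a a' y].
    have ty := VW y Vy.
    have ey i : e i y = frame t y i by rewrite eE b1 // scale1r.
    rewrite /contract_form b1 // scale1r.
    rewrite -[RHS](contract_top_form (fun i => triv_map_frame hA i tE ty)
      (triv_map_inj hA tE ty) (a y) (det_form_basis (fun i => triv_map_frame hA i tE ty))).
    congr contract; apply: eq_bigr => i _; rewrite ey; congr ((_ * a y _) *: _).
    by apply/funext => p; rewrite ey.
  rewrite scaler_sumr -big_split; apply: eq_bigr => i _ /=.
  by rewrite scalerA -scalerDl; congr (_ *: _); rewrite mulrCA -mulrDr.
Qed.

(* The bracket for which X |-> density * X is a morphism to [bracket]. *)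
Definition density_bracket mu X Y : section A := fun x =>
  density mu x *: bracket X Y x +
  (anchor (X x) (density mu) *: Y x - anchor (Y x) (density mu) *: X x).

Lemma smooth_density_bracket mu X Y : SF m.+1 mu -> S X -> S Y ->
  S (density_bracket mu X Y).
Proof.
move=> hmu hX hY; have hf := smooth_density hmu.
apply: smooth_section_linear => //; first exact: smooth_bracket.
have := smooth_section_linear hA (smooth_anchor hX hf) hY
  (smooth_sectionZ hA (smooth_onN openT (smooth_anchor hY hf)) hX).
congr smooth_section; apply: functional_extensionality_dep => x.
by rewrite scaleNr.
Qed.

Lemma smooth_nambu_sharp a : SF m a -> S (nambu_sharp Pi a).
Proof.
move=> ha; apply: smooth_section_local => // x0.
have [mu [rep [V [hmu hrep oV Vx [repE _]]]]] := local_contraction x0.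
exists V, (fun x => ((-1) ^+ m * density mu x) *: rep a x); split => //.
  apply: smooth_sectionZ => //; last exact: hrep.
  by apply: smooth_onM; [exact: openT|exact: smooth_cst|exact: smooth_density].
by move=> y Vy; rewrite -sharp_contract_form repE.
Qed.

Lemma lie_evalZ k f (w : section (forms k A)) X U x :
  smooth f -> SF k w -> S X -> (forall i, S (U i)) ->
  lie_eval w (fun y => f y *: X y) U x =
  f x * lie_eval w X U x + \sum_(j < k) anchor (U j x) f * w x (upd (fun i => U i x) j (X x)).
Proof.
move=> hf hw hX hU; have h0 : S (fun y => 0 : A y) by exact: smooth_section0.
have L0 : lie_eval w (fun y => 0 : A y) U x = 0.
  have := lie_eval_function_linear x (smooth_cst 1) hw h0 h0 hU.
  rewrite big1 => [|j _]; last by rewrite alt_upd0 mulr0.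
  rewrite (_ : (fun y => 1 *: 0 + 0 : A y) = (fun y => 0 : A y)); last first.
    by apply: functional_extensionality_dep => y; rewrite scaler0 addr0.
  by rewrite addr0 mul1r => /addr_idem_eq0.
have := lie_eval_function_linear x hf hw hX h0 hU; rewrite L0 addr0 => <-.
by congr (lie_eval w _ U x); apply: functional_extensionality_dep => y; rewrite addr0.
Qed.

Lemma lie_eval_local k (w z : section (forms k A)) X Y U x (V : set M) :
  SF k w -> SF k z -> S X -> S Y -> (forall i, S (U i)) -> open V -> V x ->
  (forall y, V y -> w y = z y) -> (forall y, V y -> X y = Y y) ->
  lie_eval w X U x = lie_eval z Y U x.
Proof.
move=> hw hz hX hY hU oV Vx wz XY; rewrite /lie_eval XY // wz //; congr (_ - _).
  apply: (anchor_local _ (smooth_eval_form hw hU) (smooth_eval_form hz hU) oV Vx).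
  by move=> y Vy; rewrite /eval_form wz.
apply: eq_bigr => j _; congr (z x (upd _ _ _)).
by rewrite bracketC // [RHS]bracketC // (bracket_local (hU j) hX hY oV Vx XY).
Qed.

Lemma koszul_local k (w z : section (forms k A)) U x (V : set M) :
  SF k w -> SF k z -> (forall i, S (U i)) -> open V -> V x ->
  (forall y, V y -> w y = z y) -> koszul w U x = koszul z U x.
Proof.
move=> hw hz hU oV Vx wz; rewrite /koszul; congr (_ + _).
  apply: eq_bigr => i _; congr (_ * _).
  apply: (anchor_local _ (smooth_eval_form hw _) (smooth_eval_form hz _) oV Vx) => //.
  by move=> y Vy; rewrite /eval_form wz.
by rewrite wz.
Qed.

(** Let eps = (-1)^m; here the rank is m + 1. Near x, Pi^# a = eps f X, so the Lie derivative is eps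
    (f L_X i_Y mu + df /\ i_X i_Y mu). The other term of the bracket is - eps f i_Y L_X mu = - eps f
    (L_X i_Y mu - i_[X,Y] mu). The terms in L_X i_Y mu cancel, and [cramer] rewrites the one in
    df. *)
Lemma nambu_bracket_contract mu X Y a b x (V : set M) :
  SF m.+1 mu -> S X -> S Y -> SF m a -> SF m b -> open V -> V x ->
  (forall y, V y -> contract_form X mu y = a y) ->
  (forall y, V y -> contract_form Y mu y = b y) ->
  nambu_bracket Pi a b x = contract ((-1) ^+ m *: density_bracket mu X Y x) (mu x).
Proof.
move=> hmu hX hY ha hb oV Vx aX bY; set f := density mu.
have hf : smooth f by exact: smooth_density.
have [ext [hext extx _]] := section_extension hA x.
apply: altform_eq => v; pose U i := ext (v i).
have hU i : S (U i) by exact: hext.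
have -> : v = (fun i => U i x) by apply/funext => i; rewrite /U extx.
set u := fun i => U i x; pose eps : R := (-1) ^+ m.
have [_ cov _] := hA; have [t tE tx] := cov x.
have ce i := triv_map_frame hA i tE tx; have ci := triv_map_inj hA tE tx.
have cY : SF m (contract_form Y mu) by exact: smooth_contract_form.
have cX : SF m (contract_form X mu) by exact: smooth_contract_form.
have heps : smooth (fun y => eps * f y).
  by apply: smooth_onM; [exact: openT|exact: smooth_cst|exact: hf].
pose L := lie_eval (contract_form Y mu) X U x.
pose W (w : A x) := mu x (cons_arg w u).
have lieE : lie_derivative (nambu_sharp Pi a) b x u =
    eps * f x * L + eps * \sum_(j < m) anchor (U j x) f * contract_form Y mu x (upd u j (X x)).
  rewrite lie_derivativeE //; last exact: smooth_nambu_sharp.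
  have hfX : S (fun y => (eps * f y) *: X y) by exact: smooth_sectionZ.
  rewrite (lie_eval_local (z := contract_form Y mu) hb cY (smooth_nambu_sharp ha) hfX hU oV Vx).
  - rewrite lie_evalZ //; congr (_ + _); rewrite mulr_sumr; apply: eq_bigr => j _.
    by rewrite anchorZ // mulrA.
  - by move=> y /bY.
  - by move=> y /aX E; rewrite /nambu_sharp -E; exact: sharp_contract_form.
(* Since d mu has degree m + 2, it vanishes, and Cartan's formula gives d (i_X mu) = L_X mu; then
   L_X is commuted with i_Y. *)
have dE : pairing (Pi x) (d_A a x) * b x u = f x * (L - W (bracket X Y x)).
  have := congr1 (fun z : altform (A x) m.+1 => z (cons_arg (Y x) u))
    (top_pairing_comm ce ci (Pi x) (mu x) (d_A a x)).
  rewrite !altformZ -(bY x Vx) => ->; congr (_ * _).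
  rewrite -eval_tcons d_AE //; last exact: smooth_tcons.
  have hYU := smooth_tcons hY hU.
  rewrite (koszul_local ha cX hYU oV Vx); last by move=> y /aX.
  have := koszul_cartan mu X (tcons Y U) x.
  have -> : koszul mu (tcons X (tcons Y U)) x = 0.
    rewrite -d_AE //; last exact: smooth_tcons.
    by rewrite (alt_high_degree ce ci (d_A mu x)).
  move=> /esym/eqP; rewrite subr_eq0 => /eqP <-.
  rewrite lie_eval_tcons /L /lie_eval addrAC.
  congr (anchor _ _ - _ - _).
  by apply/funext => y; rewrite eval_contract.
(* Cramer's rule for the tuple (Y, U), the vector X and the linear function v |-> rho(v)(f). *)
have cramer : W (X x) * anchor (Y x) f +
    \sum_(j < m) anchor (U j x) f * contract_form Y mu x (upd u j (X x)) =
    W (Y x) * anchor (X x) f.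
  have blin k w w' : anchor (k *: w + w' : A x) f = k * anchor w f + anchor w' f.
    exact: anchor_vector_linear.
  rewrite /W -(top_form_cramer ce ci (mu x) (cons_arg (Y x) u) (X x) blin) big_ord_recl cons_arg0.
  congr (_ * _ + _).
    congr (mu x _); apply/esym; exact: (@tcons_upd0 _ m (Y x) u (X x)).
  apply: eq_bigr => j _; rewrite cons_argS mulrC; congr (_ * _).
  rewrite /= /contract_fun; congr (mu x _).
  exact: (@tcons_upd _ m (Y x) u j (X x)).
have -> : nambu_bracket Pi a b x u = lie_derivative (nambu_sharp Pi a) b x u +
    (-1) ^+ m.+1 * (pairing (Pi x) (d_A a x) * b x u) by rewrite mulrA.
rewrite lieE dE exprS mulN1r -/eps.
have Wlin k w w' : W (k *: w + w') = k * W w + W w'.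
  have E z : cons_arg z u = upd (cons_arg 0 u) ord0 z by exact/esym/tcons_upd0.
  by rewrite /W (E (k *: w + w')) (E w) (E w') alt_linear.
have W0 : W 0 = 0.
  by have := Wlin 1 0 0; rewrite scaler0 addr0 mul1r => /addr_idem_eq0.
have WZ k w : W (k *: w) = k * W w by rewrite -[k *: w]addr0 Wlin W0 addr0.
have -> : contract (eps *: density_bracket mu X Y x) (mu x) u =
    eps * (f x * W (bracket X Y x) + (anchor (X x) f * W (Y x) - anchor (Y x) f * W (X x))).
  transitivity (W (eps *: density_bracket mu X Y x)); first by [].
  by rewrite WZ /density_bracket Wlin -scaleNr Wlin WZ mulNr.
move: cramer; set Sg := \sum_(j < m) _ => cramer.
have -> : Sg = W (Y x) * anchor (X x) f - W (X x) * anchor (Y x) f.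
  by rewrite -cramer addrC addKr.
move: (L) (W _) (W _) (W _) (anchor _ _) (anchor _ _) (f x) => l w1 w2 w3 p q g.
ring.
Qed.

End Nambu.

(** * The bracket {X,Y} = f [X,Y] + X(f) Y - Y(f) X *)

Section DensityBracket.
Variables (R : realType) (n : nat) (M : manifold R n) (m : nat).
Variable A : lie_algebroid M m.+1.
Variable Pi : section (multivectors m.+1 A).
Hypothesis Pi_smooth : smooth_section Pi.
Variable mu : section (forms m.+1 A).
Hypothesis mu_smooth : smooth_section mu.
Implicit Types (X Y Z : section A).
Local Notation S := (@smooth_section R n M _ A).
Local Notation f := (density Pi mu).
Local Notation db := (density_bracket Pi mu).
Let hA : is_vector_bundle A := lie_algebroid_bundle A.
Let hf : smooth f. Proof. exact: smooth_density. Qed.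

Lemma density_bracketC X Y x : S X -> S Y -> db X Y x = - db Y X x.
Proof.
move=> hX hY; rewrite /density_bracket (bracketC x hX hY).
by rewrite scalerN opprD opprB.
Qed.

Lemma density_bracket_linear_r k X Y Z x : S X -> S Y -> S Z ->
  db X (fun y => k *: Y y + Z y) x = k *: db X Y x + db X Z x.
Proof.
move=> hX hY hZ; rewrite /density_bracket bracket_linear_r // anchor_vector_linear //.
have [_ cov _] := hA; have [t tE tx] := cov x.
(* Passing to coordinates turns an identity between vectors into one between numbers, which [ring]
   decides. *)
apply: (triv_map_inj hA tE tx); apply/rowP => i.
rewrite !(linearD, linearB, linearZ) /= !mxE.
move: (anchor _ _) (anchor _ _) (anchor _ _) => p q s.
move: (triv_map _ _ _ _ _) (triv_map _ _ _ _ _) (triv_map _ _ _ _ _).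
move: (triv_map _ _ _ _ _) (triv_map _ _ _ _ _) => *.
ring.
Qed.

Lemma density_bracketZr g X Y x : S X -> S Y -> smooth g ->
  db X (fun y => g y *: Y y) x = g x *: db X Y x + (f x * anchor (X x) g) *: Y x.
Proof.
move=> hX hY hg; rewrite /density_bracket bracketZr //.
rewrite (anchor_vectorZ (g x) (Y x) hf).
have [_ cov _] := hA; have [t tE tx] := cov x.
apply: (triv_map_inj hA tE tx); apply/rowP => i.
rewrite !(linearD, linearB, linearZ) /= !mxE.
move: (anchor _ _) (anchor _ _) (anchor _ _) => p q s.
move: (triv_map _ _ _ _ _) (triv_map _ _ _ _ _) (triv_map _ _ _ _ _) => a b c.
ring.
Qed.

(** Since [fX, fY] = f {X,Y}, the identity could be transported from [bracket] where f is non-zero,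
    but not at the zeros of f. A full expansion covers all points alike. *)
Lemma density_bracket_jacobi X Y Z x : S X -> S Y -> S Z ->
  db X (db Y Z) x + db Y (db Z X) x + db Z (db X Y) x = 0.
Proof.
have E X' Y' Z' : S X' -> S Y' -> S Z' -> db X' (db Y' Z') x =
    (f x * f x) *: bracket X' (bracket Y' Z') x +
    (2 * f x * anchor (X' x) f) *: bracket Y' Z' x +
    (f x * anchor (Y' x) f) *: bracket X' Z' x -
    (f x * anchor (Z' x) f) *: bracket X' Y' x +
    (f x * anchor (X' x) (fun y => anchor (Y' y) f) + anchor (X' x) f * anchor (Y' x) f) *: Z' x -
    (f x * anchor (X' x) (fun y => anchor (Z' y) f) + anchor (X' x) f * anchor (Z' x) f) *: Y' x -
    (f x * (anchor (Y' x) (fun y => anchor (Z' y) f) - anchor (Z' x) (fun y => anchor (Y' y) f))) *: X' x.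
  move=> hX hY hZ; rewrite {1}/density_bracket.
  have hYf := smooth_anchor hY hf; have hZf := smooth_anchor hZ hf.
  have hYZ := smooth_bracket hY hZ.
  have -> : bracket X' (db Y' Z') x =
      f x *: bracket X' (bracket Y' Z') x + anchor (X' x) f *: bracket Y' Z' x +
      (anchor (Y' x) f *: bracket X' Z' x + anchor (X' x) (fun y => anchor (Y' y) f) *: Z' x -
      (anchor (Z' x) f *: bracket X' Y' x + anchor (X' x) (fun y => anchor (Z' y) f) *: Y' x)).
    have h1 := smooth_sectionZ hA hYf hZ; have h2 := smooth_sectionZ hA hZf hY.
    have h3 : S (fun y => - (anchor (Z' y) f *: Y' y) : A y).
      have := smooth_sectionZ hA (smooth_cst (-1)) h2; congr smooth_section.
      by apply: functional_extensionality_dep => y; rewrite scaleN1r.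
    rewrite bracket_function_linear_r //; last exact: smooth_sectionD.
    by rewrite bracketDr // bracketNr // !bracketZr.
  (* The two correction terms contribute Y(f) Z(f) - Z(f) Y(f) = 0, so {Y,Z} acts on f as f [Y,Z]
     does, and [anchor_bracket] applies. *)
  have -> : anchor (db Y' Z' x) f = f x * (anchor (Y' x) (fun y => anchor (Z' y) f) -
      anchor (Z' x) (fun y => anchor (Y' y) f)).
    rewrite -anchor_bracket // /density_bracket anchor_vector_linear // -scaleNr.
    rewrite anchor_vector_linear // (anchor_vectorZ (- anchor (Z' x) f) (Y' x) hf).
    by rewrite mulNr [X in X - _]mulrC subrr addr0.
  rewrite /density_bracket.
  have [_ cov _] := hA; have [t tE tx] := cov x.
  apply: (triv_map_inj hA tE tx); apply/rowP => i.
  rewrite !(linearD, linearB, linearZ) /= !mxE.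
  move: (anchor _ (fun y => anchor (Y' y) f)) (anchor _ (fun y => anchor (Z' y) f)).
  move: (anchor _ (fun y => anchor (Y' y) f)).
  move: (anchor _ _) (anchor _ _) (anchor _ _) => p q s u v w.
  move: (triv_map _ _ _ _ _) (triv_map _ _ _ _ _) (triv_map _ _ _ _ _).
  move: (triv_map _ _ _ _ _) (triv_map _ _ _ _ _) (triv_map _ _ _ _ _) => *.
  move: (f x) => h.
  ring.
move=> hX hY hZ; rewrite !E //.
rewrite (bracketC x hX hZ) (bracketC x hY hX) (bracketC x hZ hY).
have := bracket_jacobi x hX hY hZ.
set j1 := bracket X (bracket Y Z) x; set j2 := bracket Y _ x; set j3 := bracket Z _ x.
move=> J.
have {J} -> : j3 = - j1 - j2.
  by apply/eqP; rewrite -opprD -addr_eq0 addrC; apply/eqP.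
have [_ cov _] := hA; have [t tE tx] := cov x.
apply: (triv_map_inj hA tE tx); apply/rowP => i.
rewrite linear0 !(linearD, linearB, linearN, linearZ) /= !mxE.
move: (triv_map t x j1 0 i) (triv_map t x j2 0 i) => a1 a2.
move: (triv_map t x (bracket Y Z x) 0 i) (triv_map t x (bracket Z X x) 0 i)
  (triv_map t x (bracket X Y x) 0 i) => c1 c2 c3.
move: (triv_map t x (X x) 0 i) (triv_map t x (Y x) 0 i) (triv_map t x (Z x) 0 i) => d1 d2 d3.
move: (anchor (X x) (fun y => anchor (Y y) f)) (anchor (X x) (fun y => anchor (Z y) f))
  (anchor (Y x) (fun y => anchor (X y) f)) (anchor (Y x) (fun y => anchor (Z y) f))
  (anchor (Z x) (fun y => anchor (X y) f)) (anchor (Z x) (fun y => anchor (Y y) f)).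
move: (anchor (X x) f) (anchor (Y x) f) (anchor (Z x) f) (f x) => *.
ring.
Qed.

End DensityBracket.

(** * The algebroid axioms for the Nambu bracket, checked near each point *)

Section NambuBracket.
Variables (R : realType) (n : nat) (M : manifold R n) (m : nat).
Variable A : lie_algebroid M m.+1.
Variable Pi : section (multivectors m.+1 A).
Hypothesis Pi_smooth : smooth_section Pi.
Implicit Types (a b c : section (forms m A)).
Local Notation S := (@smooth_section R n M _ A).
Local Notation SF := (@smooth_section R n M _ (forms m A)).
Let hA : is_vector_bundle A := lie_algebroid_bundle A.
Let hF : is_vector_bundle (forms m A) := forms_vector_bundle hA m.

Lemma smooth_nambu_bracket a b : SF a -> SF b -> SF (nambu_bracket Pi a b).
Proof.
move=> ha hb; apply: smooth_section_local => // x0.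
have [mu [rep [V [hmu hrep oV Vx [repE _]]]]] := local_contraction A x0.
exists V, (contract_form (fun y => (-1) ^+ m *: density_bracket Pi mu (rep a) (rep b) y) mu).
split => //.
  apply: smooth_contract_form => //; apply: smooth_sectionZ => //.
    exact: smooth_cst.
  by apply: smooth_density_bracket => //; exact: hrep.
move=> y Vy; apply/esym.
by apply: (nambu_bracket_contract Pi_smooth hmu (hrep a ha) (hrep b hb) ha hb oV Vy) => z Vz;
  exact: repE.
Qed.

(** X and Y stay free in the third clause because [rep] is linear over constants only: the forms g b
    and [b, c] are represented by g [rep b] and by a multiple of {[rep b], [rep c]}, not through
    [rep]. *)
Lemma nambu_bracket_rep x0 : exists mu (rep : section (forms m A) -> section A) (V : set M),
  [/\ smooth_section mu, forall a, SF a -> S (rep a), open V, V x0 &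
   [/\ forall a y, V y -> contract_form (rep a) mu y = a y,
       forall k a b y, rep (fun z => k *: a z + b z) y = k *: rep a y + rep b y,
       forall X Y a b, S X -> S Y -> SF a -> SF b ->
         (forall y, V y -> contract_form X mu y = a y) ->
         (forall y, V y -> contract_form Y mu y = b y) ->
         forall y, V y -> nambu_bracket Pi a b y =
           contract ((-1) ^+ m *: density_bracket Pi mu X Y y) (mu y) &
       forall a y, V y -> sharp (Pi y) (a y) = ((-1) ^+ m * density Pi mu y) *: rep a y]].
Proof.
have [mu [rep [V [hmu hrep oV Vx [repE repl]]]]] := local_contraction A x0.
exists mu, rep, V; split => //; split => //.
  move=> X Y a b hX hY ha hb aX bY y Vy.
  exact: (nambu_bracket_contract Pi_smooth hmu hX hY ha hb oV Vy).
by move=> a y Vy; rewrite -sharp_contract_form repE.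
Qed.

Lemma nambu_bracketC a b x : SF a -> SF b -> nambu_bracket Pi a b x = - nambu_bracket Pi b a x.
Proof.
move=> ha hb; have [mu [rep [V [hmu hrep oV Vx [repE _ nbE _]]]]] := nambu_bracket_rep x.
have E c d : SF c -> SF d -> nambu_bracket Pi c d x =
    contract ((-1) ^+ m *: density_bracket Pi mu (rep c) (rep d) x) (mu x).
  by move=> hc hd; apply: nbE => //; try exact: hrep; move=> y; exact: repE.
rewrite !E // density_bracketC //; try exact: hrep.
by rewrite scalerN contractN.
Qed.

Lemma nambu_bracket_linear_r k a b c x : SF a -> SF b -> SF c ->
  nambu_bracket Pi a (fun y => k *: b y + c y) x =
  k *: nambu_bracket Pi a b x + nambu_bracket Pi a c x.
Proof.
move=> ha hb hc; have [mu [rep [V [hmu hrep oV Vx [repE repl nbE _]]]]] := nambu_bracket_rep x.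
have E d d' : SF d -> SF d' -> nambu_bracket Pi d d' x =
    contract ((-1) ^+ m *: density_bracket Pi mu (rep d) (rep d') x) (mu x).
  by move=> hd hd'; apply: nbE => //; try exact: hrep; move=> y; exact: repE.
have hbc : SF (fun y => k *: b y + c y) by apply: smooth_section_linear => //; exact: smooth_cst.
rewrite !E //.
have -> : rep (fun y => k *: b y + c y) = (fun y => k *: rep b y + rep c y).
  by apply: functional_extensionality_dep => y; exact: repl.
rewrite density_bracket_linear_r //; try exact: hrep.
by rewrite scalerDr scalerA mulrC -scalerA contract_linear.
Qed.

Lemma nambu_bracketZr a b g x : SF a -> SF b -> smooth g ->
  nambu_bracket Pi a (fun y => g y *: b y) x =
  g x *: nambu_bracket Pi a b x + nambu_anchor Pi (a x) g *: b x.
Proof.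
move=> ha hb hg; have [mu [rep [V [hmu hrep oV Vx [repE repl nbE shE]]]]] := nambu_bracket_rep x.
have hga : SF (fun y => g y *: b y) by exact: smooth_sectionZ.
have rX := hrep a ha; have rY := hrep b hb.
rewrite (nbE (rep a) (fun y => g y *: rep b y)) //; first last.
- move=> y Vy; rewrite /contract_form contractZ; congr (_ *: _); exact: repE.
- by move=> y; exact: repE.
- exact: smooth_sectionZ.
rewrite (nbE (rep a) (rep b)) //; first last.
- by move=> y; exact: repE.
- by move=> y; exact: repE.
rewrite density_bracketZr // scalerDr contractD; congr (_ + _).
  by rewrite scalerA mulrC -scalerA contractZ.
rewrite /nambu_anchor shE // -(repE b x Vx) scalerA contractZ; congr (_ *: _).
by rewrite anchor_vectorZ // mulrA.
Qed.

Lemma nambu_bracket_jacobi a b c x : SF a -> SF b -> SF c ->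
  nambu_bracket Pi a (nambu_bracket Pi b c) x +
  nambu_bracket Pi b (nambu_bracket Pi c a) x +
  nambu_bracket Pi c (nambu_bracket Pi a b) x = 0.
Proof.
move=> ha hb hc; have [mu [rep [V [hmu hrep oV Vx [repE repl nbE _]]]]] := nambu_bracket_rep x.
have E d d' d'' : SF d -> SF d' -> SF d'' -> nambu_bracket Pi d (nambu_bracket Pi d' d'') x =
    contract (density_bracket Pi mu (rep d) (density_bracket Pi mu (rep d') (rep d'')) x) (mu x).
  move=> hd hd' hd''; have r1 := hrep d hd; have r2 := hrep d' hd'; have r3 := hrep d'' hd''.
  have hdb := smooth_density_bracket Pi_smooth hmu r2 r3.
  (* The inner bracket is the contraction with (-1)^m {d', d''}. The constant comes out of the outer
     bracket, where a second (-1)^m cancels it. *)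
  rewrite (nbE (rep d) (fun y => (-1) ^+ m *: density_bracket Pi mu (rep d') (rep d'') y)) //.
  - rewrite density_bracketZr //; last exact: smooth_cst.
    by rewrite anchor_cst mulr0 scale0r addr0 scalerA -expr2 sqrr_sign scale1r.
  - by apply: smooth_sectionZ => //; exact: smooth_cst.
  - exact: smooth_nambu_bracket.
  - by move=> y; exact: repE.
  - move=> y Vy; rewrite (nbE (rep d') (rep d'')) //; by move=> z; exact: repE.
rewrite !E // -!contractD density_bracket_jacobi ?contract0 //; exact: hrep.
Qed.

End NambuBracket.

Theorem proposition3p22 (R : realType) (n : nat) (M : manifold R n)
    (m' : nat) (hm : (3 <= m'.+1)%N)
    (A : lie_algebroid M m'.+1)
    (pos : forall x : M, ('I_m'.+1 -> A x) -> Prop)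
    (hpos : is_orientation pos)
    (Pi : section (multivectors m'.+1 A))
    (Pi_smooth : smooth_section Pi)
    (Pi_neq0 : exists x : M, Pi x <> 0%R) :
  is_lie_algebroid (nambu_anchor Pi) (nambu_bracket Pi).
Proof.
have hA := lie_algebroid_bundle A.
have hF := forms_vector_bundle hA m'.
split => //.
- split.
  + move=> x v; have [_ [h _ _] _ _ _] := lie_algebroidP A; exact: h.
  + move=> x k u v g hg.
    by rewrite /nambu_anchor sharp_linear anchor_vector_linear.
  + move=> a g ha hg; apply: smooth_anchor => //; exact: smooth_nambu_sharp.
- split.
  + by move=> a b ha hb; exact: smooth_nambu_bracket.
  + move=> k a b c ha hb hc x.
    rewrite nambu_bracketC //; last first.
      by apply: smooth_section_linear => //; exact: smooth_cst.
    rewrite nambu_bracket_linear_r // [nambu_bracket Pi a c x]nambu_bracketC //.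
    by rewrite [nambu_bracket Pi b c x]nambu_bracketC // scalerN opprD.
  + by move=> k a b c ha hb hc x; exact: nambu_bracket_linear_r.
- split; first by move=> a b ha hb x; exact: nambu_bracketC.
  by move=> a b c ha hb hc x; exact: nambu_bracket_jacobi.
- by move=> a b g ha hb hg x; exact: nambu_bracketZr.
Qed.
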